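(* Let $\Bbbk$ be an algebraically closed field of characteristic zero and let $A$ be a Poisson Hopf $\Bbbk$-algebra. Suppose that (i) as an algebra, $A$ is finitely generated and connected graded, $A=\bigoplus_{i\ge 0}A(i)$ with $A(0)=\Bbbk$; and (ii) the Poisson bracket $\{-,-\}$ is homogeneous of degree $d\geq 0$, i.e. $\{A(i),A(j)\}\subseteq A(i+j+d)$ for all $i,j$. Then $A$ is unimodular; that is, the modular derivation of $A$ is zero.
   Context: A Poisson algebra is a commutative associative $\Bbbk$-algebra $A$ with a bilinear bracket $\{-,-\}$ making $A$ a Lie algebra and satisfying the Leibniz rule $\{ab,c\}=a\{b,c\}+\{a,c\}b$. If $A,B$ are Poisson algebras, $A\otimes B$ is Poisson with $\{a\otimes b,c\otimes d\}=\{a,c\}\otimes bd+ac\otimes\{b,d\}$. A Poisson Hopf algebra is a Poisson algebra $A$ which is also a Hopf algebra such that the comultiplication $\Delta:A\to A\otimes A$ is a Poisson algebra morphism. An algebra satisfying (i) that is a commutative Hopf algebra over $\Bbbk$ is a polynomial algebra $\Bbbk[x_1,\dots,x_n]$. For a Poisson polynomial algebra $A=\Bbbk[x_1,\dots,x_n]$, the modular derivation (with respect to the volume form $dx_1\wedge\cdots\wedge dx_n$) is the Poisson derivation $\delta$ given by $\delta(f)=\sum_{j=1}^n \frac{\partial \{f,x_j\}}{\partial x_j}$ for $f\in A$; $A$ is called unimodular if the class of $\delta$ modulo log-Hamiltonian derivations is trivial, which for a polynomial algebra (whose only units are scalars) means exactly $\delta=0$. *)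

(* Defs.v *)
From HB Require Import structures.
From mathcomp Require Import all_boot all_order all_algebra.
From mathcomp Require Import mpoly.
From Stdlib Require Import ClassicalEpsilon.

Set Implicit Arguments.
Unset Strict Implicit.
Unset Printing Implicit Defensive.

Import GRing.Theory.
Local Open Scope ring_scope.

Section PoissonHopfDefs.
Variable K : fieldType.

Definition lin (U W : lmodType K) (g : U -> W) : Prop :=
  forall (c : K) (x y : U), g (c *: x + y) = c *: g x + g y.

Definition bilin (U V W : lmodType K) (f : U -> V -> W) : Prop :=
  (forall u, lin (f u)) /\ (forall v, lin (fun u => f u v)).

Definition is_tensor (U V T : lmodType K) (t : U -> V -> T) : Prop :=
  bilin t /\
  forall (W : lmodType K) (f : U -> V -> W), bilin f ->
    exists g : T -> W,
      [/\ lin g, (forall u v, g (t u v) = f u v) &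
          forall g' : T -> W, lin g' -> (forall u v, g' (t u v) = f u v) ->
            forall x, g' x = g x].

(** The linear map [T -> W] induced by a bilinear map [f] through the
    tensor product [t] (chosen by Hilbert's epsilon; it is the unique such
    linear map whenever [is_tensor t] and [bilin f]). *)
Definition tlift (U V T W : lmodType K) (t : U -> V -> T) (f : U -> V -> W)
    : T -> W :=
  epsilon (inhabits (fun _ : T => (0 : W)))
          (fun g => lin g /\ forall u v, g (t u v) = f u v).

Definition poisson_bracket (A : comAlgType K) (br : A -> A -> A) : Prop :=
  [/\ bilin br,
      (forall a, br a a = 0),
      (forall a b c, br a (br b c) + br b (br c a) + br c (br a b) = 0) &
      (forall a b c, br (a * b) c = a * br b c + br a c * b)].

Definition tmul (A : comAlgType K) (T : lmodType K) (t : A -> A -> T)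
    : T -> T -> T :=
  fun X Y => tlift t (fun a b => tlift t (fun c d => t (a * c) (b * d)) Y) X.

Definition tbracket (A : comAlgType K) (T : lmodType K) (t : A -> A -> T)
    (br : A -> A -> A) : T -> T -> T :=
  fun X Y => tlift t (fun a b =>
     tlift t (fun c d => t (br a c) (b * d) + t (a * c) (br b d)) Y) X.

Definition is_poisson_hopf (A : comAlgType K) (br : A -> A -> A)
    (T : lmodType K) (t : A -> A -> T) (T3 : lmodType K) (t3 : T -> A -> T3)
    (Delta : A -> T) (eps : A -> K) (S : A -> A) : Prop :=
  [/\ poisson_bracket br, is_tensor t, is_tensor t3,
      [/\ lin Delta, Delta 1 = t 1 1,
          (forall a b, Delta (a * b) = tmul t (Delta a) (Delta b)) &
          [/\ (forall (c : K) x y, eps (c *: x + y) = c * eps x + eps y),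
               eps 1 = 1 &
               forall a b, eps (a * b) = eps a * eps b]] &
      [/\
          (forall x, tlift t (fun a b => tlift t (fun y z => t3 (t y z) b) (Delta a))
                           (Delta x)
                   = tlift t (fun a b => tlift t (fun y z => t3 (t a y) z) (Delta b))
                           (Delta x)),
          (forall x, tlift t (fun a b => eps a *: b) (Delta x) = x),
          (forall x, tlift t (fun a b => eps b *: a) (Delta x) = x),
          [/\ lin S,
              (forall x, tlift t (fun a b => S a * b) (Delta x) = (eps x)%:A) &
              (forall x, tlift t (fun a b => a * S b) (Delta x) = (eps x)%:A)] &
          forall a b, Delta (br a b) = tbracket t br (Delta a) (Delta b)]].

Definition fin_gen_alg (A : comAlgType K) : Prop :=
  exists s : seq A, forall P : A -> Prop,
    P 1 -> (forall x, x \in s -> P x) ->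
    (forall (c : K) x y, P x -> P y -> P (c *: x + y)) ->
    (forall x y, P x -> P y -> P (x * y)) ->
    forall a, P a.

Definition connected_graded (A : comAlgType K) (G : nat -> A -> Prop) : Prop :=
  [/\ (forall i, G i 0 /\ forall (c : K) x y, G i x -> G i y -> G i (c *: x + y)),
      (forall a, exists N (c : nat -> A), (forall i, G i (c i)) /\ a = \sum_(i < N) c i),
      (forall N (c : nat -> A), (forall i, G i (c i)) -> \sum_(i < N) c i = 0 ->
          forall i, (i < N)%N -> c i = 0),
      (forall i j a b, G i a -> G j b -> G (i + j)%N (a * b)) &
      (forall a, G 0%N a <-> exists c : K, a = c%:A)].

Definition bracket_homogeneous (A : comAlgType K) (G : nat -> A -> Prop)
    (br : A -> A -> A) (d : nat) : Prop :=
  forall i j a b, G i a -> G j b -> G (i + j + d)%N (br a b).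

Definition poly_alg_iso (n : nat) (A : comAlgType K)
    (phi : {mpoly K[n]} -> A) (psi : A -> {mpoly K[n]}) : Prop :=
  [/\ lin phi, phi 1 = 1, (forall p q, phi (p * q) = phi p * phi q),
      cancel phi psi & cancel psi phi].

(** Modular derivation of a Poisson bracket [brP] on K[x_1..x_n] w.r.t.
    dx_1 /\ ... /\ dx_n :  delta(f) = sum_j d {f, x_j} / d x_j. *)
Definition modular_derivation (n : nat)
    (brP : {mpoly K[n]} -> {mpoly K[n]} -> {mpoly K[n]}) (f : {mpoly K[n]})
    : {mpoly K[n]} :=
  \sum_(j < n) mderiv j (brP f 'X_j).

End PoissonHopfDefs.

(* Main.v *)
Require Import Defs.
From HB Require Import structures.
From mathcomp Require Import all_boot all_order all_algebra.
From mathcomp Require Import perm mpoly ring.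
From Stdlib Require Import ClassicalEpsilon FunctionalExtensionality.

Set Implicit Arguments.
Unset Strict Implicit.
Unset Printing Implicit Defensive.

Import GRing.Theory.
Local Open Scope ring_scope.

(** Let [o] be the character killing all components of positive degree, and
    write [*] for the convolution product. An [o]-derivation [xi] extends to the
    invariant derivations [L = id * (o S) * xi] and [R = xi * (o S) * id] of [A],
    and [o L = o R = xi].

    Polynomiality: let [x] be homogeneous elements forming a basis of [m/m^2],
    where [m = ker o]. They generate [A]. Applying the [L_i] dual to [x] to a
    relation [p(x) = 0] and using graded Nakayama gives [(d_j p)(x) = 0] for
    all [j]; in characteristic zero, induction on the degree yields [p = 0].

    Unimodularity: in coordinates [y], the matrices [(L_i y_j)] and [(R_i y_j)]
    are invertible, with scalar determinants since units are scalars. As the Lie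
    derivative of the bracket along [R_i] has constant coefficients in the frame
    [R], the divergence [delta a] of [{a, -}] equals [sum_i w_i (R_i a)] up to a
    constant combination of the [R_k a], where [{a, -} = sum_i w_i(a) R_i]. The
    constants vanish because [delta] and the bracket vanish at [o], by
    homogeneity. The same holds for [L]. Writing [{a, b} = sum q_ki L_k(a) R_i(b)]
    and using [[L_k, R_i] = 0], the two expressions of [delta a] are opposite
    to each other, so [2 delta = 0]. *)

(** * Linear maps *)

Section Linear.
Variable K : fieldType.
Implicit Types U V W : lmodType K.

Lemma lin0 U V (f : U -> V) : lin f -> f 0 = 0.
Proof.
by move=> lf; have := lf (-1) 0 0; rewrite !scaleN1r oppr0 addr0 addNr.
Qed.

Lemma linD U V (f : U -> V) x y : lin f -> f (x + y) = f x + f y.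
Proof. by move=> lf; have := lf 1 x y; rewrite !scale1r. Qed.

Lemma linZ U V (f : U -> V) c x : lin f -> f (c *: x) = c *: f x.
Proof. by move=> lf; have := lf c x 0; rewrite (lin0 lf) !addr0. Qed.

Lemma linB U V (f : U -> V) x y : lin f -> f (x - y) = f x - f y.
Proof. by move=> lf; rewrite linD // -!scaleN1r linZ. Qed.

Lemma lin_sum U V (f : U -> V) (I : Type) (r : seq I) (P : pred I) (F : I -> U) :
  lin f -> f (\sum_(i <- r | P i) F i) = \sum_(i <- r | P i) f (F i).
Proof.
move=> lf; elim/big_rec2: _ => [|i x y _ <-]; first exact: lin0.
exact: linD.
Qed.

Lemma lin_bigsum U V (I : Type) (r : seq I) (F : I -> U -> V) :
  (forall i, lin (F i)) -> lin (fun x => \sum_(i <- r) F i x).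
Proof.
move=> lF c x y; rewrite scaler_sumr -big_split /=.
by apply: eq_bigr => i _; rewrite lF.
Qed.

Lemma lin_comp U V W (f : V -> W) (g : U -> V) :
  lin f -> lin g -> lin (fun x => f (g x)).
Proof. by move=> lf lg c x y; rewrite lg lf. Qed.

Lemma lin_id U : lin (fun x : U => x).
Proof. by []. Qed.

Lemma lin_mull (A : comAlgType K) U (a : A) (f : U -> A) :
  lin f -> lin (fun x => a * f x).
Proof. by move=> lf c x y; rewrite lf mulrDr scalerAr. Qed.

Lemma lin_mulr (A : comAlgType K) U (a : A) (f : U -> A) :
  lin f -> lin (fun x => f x * a).
Proof. by move=> lf c x y; rewrite lf mulrDl scalerAl. Qed.

End Linear.

(** * Tensor products: pure tensors and lifts of bilinear maps *)

Section TensorSpan.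
Variables (K : fieldType) (U V T : lmodType K) (t : U -> V -> T).
Hypothesis tP : is_tensor t.

Definition tsum (s : seq (U * V)) : T := \sum_(p <- s) t p.1 p.2.

(** Excluded middle makes the predicate boolean, as the subtype and submodule structures below
    require. *)
Definition in_span : pred T :=
  fun x => if excluded_middle_informative (exists s, x = tsum s) then true else false.

Lemma in_spanP x : reflect (exists s, x = tsum s) (in_span x).
Proof. by rewrite /in_span; case: excluded_middle_informative => h; constructor. Qed.

Fact in_span_submod : submod_closed in_span.
Proof.
split; first by apply/in_spanP; exists [::]; rewrite /tsum big_nil.
move=> c x y /in_spanP [s ->] /in_spanP [s' ->]; apply/in_spanP.
exists ([seq (c *: p.1, p.2) | p <- s] ++ s').
rewrite /tsum big_cat big_map scaler_sumr; congr (_ + _).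
by apply: eq_bigr => p _ /=; have [[_ h] _] := tP; rewrite (linZ _ _ (h p.2)).
Qed.

HB.instance Definition _ := GRing.isSubmodClosed.Build K T in_span in_span_submod.

Record span_type := SpanType { span_val :> T; _ : in_span span_val }.
HB.instance Definition _ := [isSub for span_val].
HB.instance Definition _ := [Choice of span_type by <:].
HB.instance Definition _ := [SubChoice_isSubLmodule of span_type by <:].

Lemma in_span_tensor u v : in_span (t u v).
Proof. by apply/in_spanP; exists [:: (u, v)]; rewrite /tsum big_seq1. Qed.

(* The universal property maps [T] back into the span of pure tensors; by
   uniqueness the composite with the inclusion is the identity. *)
Lemma tensor_span x : exists s, x = tsum s.
Proof.
have [[tr tl] univ] := tP.
pose f u v : span_type := SpanType (in_span_tensor u v).
have bf : bilin f.
  by split=> [u c a b | v c a b]; apply: val_inj => /=; [apply: tr | apply: tl].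
have [g [lg gf _]] := univ _ f bf.
have [h [_ _ huniq]] := univ _ t (conj tr tl).
have gx : (g x : T) = x.
  transitivity (h x).
    by apply: (huniq (fun z => g z : T)) => [c a b | u v]; rewrite ?lg ?gf.
  by symmetry; apply: (huniq id).
rewrite -gx; exact/in_spanP/(valP (g x)).
Qed.

End TensorSpan.

Section TensorLift.
Variables (K : fieldType) (U V T W : lmodType K) (t : U -> V -> T).
Variable f : U -> V -> W.
Hypotheses (tP : is_tensor t) (bf : bilin f).

Lemma tlift_spec : lin (tlift t f) /\ forall u v, tlift t f (t u v) = f u v.
Proof.
apply: (@epsilon_spec _ (inhabits (fun _ : T => (0 : W)))
  (fun g => lin g /\ forall u v, g (t u v) = f u v)).
by have [_ /(_ W f bf) [g [lg gf _]]] := tP; exists g.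
Qed.

Lemma lin_tlift : lin (tlift t f).
Proof. by case: tlift_spec. Qed.

Lemma tlift_tsum s : tlift t f (tsum t s) = \sum_(p <- s) f p.1 p.2.
Proof.
have [lg gt] := tlift_spec; rewrite (lin_sum _ _ _ lg).
by apply: eq_bigr => p _; rewrite gt.
Qed.

End TensorLift.

(** * The coproduct as a convolution of linear endomorphisms *)

Section Sweedler.
Variables (K : fieldType) (A : comAlgType K).

(* [dl a] is a list of pairs [(a1, a2)] with [Delta a = sum a1 (x) a2]. *)
Definition conv (dl : A -> seq (A * A)) (phi psi : A -> A) : A -> A :=
  fun a => \sum_(p <- dl a) phi p.1 * psi p.2.

Definition algmor (phi : A -> A) : Prop :=
  [/\ lin phi, phi 1 = 1 & forall a b, phi (a * b) = phi a * phi b].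

(** For [chi] the identity these are the derivations of [A]; for [chi] a scalar character, tangent
    vectors at that point, possibly with coefficients in [A]. *)
Definition deriv_along (chi X : A -> A) : Prop :=
  lin X /\ forall a b, X (a * b) = chi a * X b + X a * chi b.

(** The axioms are contracted with linear endomorphisms of [A], so that no tensor product remains.
    The counit takes values in [A], as multiples of 1, and can thus be convolved like any
    endomorphism. *)
Record sweedler (br : A -> A -> A) (dl : A -> seq (A * A)) (eps S : A -> A)
  : Prop := Sweedler {
  sw_lin : forall phi psi, lin phi -> lin psi -> lin (conv dl phi psi);
  sw_one : forall phi psi, lin phi -> lin psi ->
    conv dl phi psi 1 = phi 1 * psi 1;
  sw_assoc : forall phi psi chi, lin phi -> lin psi -> lin chi ->
    conv dl (conv dl phi psi) chi = conv dl phi (conv dl psi chi);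
  sw_mul : forall phi psi a b, lin phi -> lin psi ->
    conv dl phi psi (a * b) = \sum_(p <- dl a) \sum_(q <- dl b)
      phi (p.1 * q.1) * psi (p.2 * q.2);
  sw_br : forall phi psi a b, lin phi -> lin psi ->
    conv dl phi psi (br a b) = \sum_(p <- dl a) \sum_(q <- dl b)
      (phi (br p.1 q.1) * psi (p.2 * q.2) + phi (p.1 * q.1) * psi (br p.2 q.2));
  sw_eps : algmor eps;
  sw_epsK : exists e : A -> K, forall a, eps a = (e a)%:A;
  sw_linS : lin S;
  sw_eps1 : conv dl eps id = id;
  sw_1eps : conv dl id eps = id;
  sw_S1 : conv dl S id = eps;
  sw_1S : conv dl id S = eps
}.

Definition opdl (dl : A -> seq (A * A)) a := [seq (p.2, p.1) | p <- dl a].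

Lemma conv_opdl dl phi psi : conv (opdl dl) phi psi = conv dl psi phi.
Proof.
apply: functional_extensionality => a; rewrite /conv big_map /=.
by apply: eq_bigr => p _; rewrite mulrC.
Qed.

(** Commutativity of [A] lets the same [S] serve for the reversed coproduct. Results on one kind of
    invariant field thereby transfer to the other. *)
Lemma sweedler_op br dl eps S : sweedler br dl eps S -> sweedler br (opdl dl) eps S.
Proof.
case=> h1 h2 h3 h4 h5 h6 h7 h8 h9 h10 h11 h12; split; rewrite ?conv_opdl //.
- by move=> phi psi l1 l2; rewrite conv_opdl; apply: h1.
- by move=> phi psi l1 l2; rewrite conv_opdl h2 // mulrC.
- by move=> phi psi chi l1 l2 l3; rewrite !conv_opdl h3.
- move=> phi psi a b l1 l2; rewrite conv_opdl h4 // big_map; apply: eq_bigr => p _.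
  by rewrite big_map; apply: eq_bigr => q _; rewrite mulrC.
- move=> phi psi a b l1 l2; rewrite conv_opdl h5 // big_map; apply: eq_bigr => p _.
  rewrite big_map; apply: eq_bigr => q _.
  by rewrite addrC; congr (_ + _); apply: mulrC.
Qed.

End Sweedler.

(** * From the tensor axioms to the convolution identities *)

Section HopfSweedler.
Variables (K : fieldType) (A : comAlgType K) (br : A -> A -> A).
Variables (T : lmodType K) (t : A -> A -> T) (T3 : lmodType K) (t3 : T -> A -> T3).
Variables (Delta : A -> T) (eps : A -> K) (S : A -> A).
Hypothesis H : is_poisson_hopf br t t3 Delta eps S.

Let tP : is_tensor t. Proof. by case: H. Qed.
Let t3P : is_tensor t3. Proof. by case: H. Qed.
Let linDelta : lin Delta. Proof. by case: H => _ _ _ []. Qed.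
Let brP : bilin br. Proof. by case: H => [[]]. Qed.

Lemma lin_tensor_r u : lin (t u). Proof. by case: tP => [[]]. Qed.
Lemma lin_tensor_l v : lin (t^~ v). Proof. by case: tP => [[]]. Qed.

Definition coprod_seq (a : A) : seq (A * A) :=
  sval (constructive_indefinite_description _ (tensor_span tP (Delta a))).

Lemma coprod_seqP a : Delta a = tsum t (coprod_seq a).
Proof. by rewrite /coprod_seq; case: constructive_indefinite_description. Qed.

Lemma tlift_Delta (W : lmodType K) (F : A -> A -> W) a : bilin F ->
  tlift t F (Delta a) = \sum_(p <- coprod_seq a) F p.1 p.2.
Proof. by move=> bF; rewrite coprod_seqP tlift_tsum. Qed.

Lemma lin_coprod_seq (W : lmodType K) (F : A -> A -> W) : bilin F ->
  lin (fun a => \sum_(p <- coprod_seq a) F p.1 p.2).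
Proof.
move=> bF c x y; rewrite -!tlift_Delta // linDelta; exact: lin_tlift.
Qed.

Lemma bilin_mul (phi psi : A -> A) :
  lin phi -> lin psi -> bilin (fun a b => phi a * psi b).
Proof. by move=> l1 l2; split=> u; [apply: lin_mull | apply: lin_mulr]. Qed.

Lemma sweedler_of_hopf :
  sweedler br coprod_seq (fun a => (eps a)%:A) S.
Proof.
case: H => _ _ _ [_ D1 DM [leps eps1 epsM]].
case=> coass cul cur [lS Sl Sr] Dbr.
have [[t3r t3l] _] := t3P.
have bprod (phi psi : A -> A) : lin phi -> lin psi -> bilin (fun a b => phi a * psi b).
  exact: bilin_mul.
have leA : lin (fun a => (eps a)%:A : A).
  by move=> c x y /=; rewrite leps scalerDl scalerA.
have lproj (phi psi : A -> A) : lin phi -> lin psi ->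
    lin (tlift t (fun a b => phi a * psi b)).
  by move=> l1 l2; exact: (lin_tlift tP (bprod _ _ l1 l2)).
have lconv phi psi : lin phi -> lin psi -> lin (conv coprod_seq phi psi).
  by move=> l1 l2; exact: (lin_coprod_seq (bprod _ _ l1 l2)).
have convE phi psi a : lin phi -> lin psi ->
    conv coprod_seq phi psi a = tlift t (fun a b => phi a * psi b) (Delta a).
  by move=> l1 l2; rewrite (tlift_Delta _ (bprod _ _ l1 l2)).
have tliftE (phi psi : A -> A) a b : lin phi -> lin psi ->
    tlift t (fun a b => phi a * psi b) (t a b) = phi a * psi b.
  by move=> l1 l2; have [_ ->] := tlift_spec tP (bprod _ _ l1 l2).
split=> //.
- by move=> phi psi l1 l2; rewrite convE // D1 tliftE.
- move=> phi psi chi l1 l2 l3; apply: functional_extensionality => x.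
  (* [G3] induces on the triple tensor product the contraction by [phi], [psi] and [chi], which is
     then applied to coassociativity. *)
  pose G3 X b := tlift t (fun a b => phi a * psi b) X * chi b.
  have bG3 : bilin G3.
    by split=> u; [apply: lin_mull | apply: lin_mulr; apply: lproj].
  have b1 b : bilin (fun y z => t3 (t y z) b).
    by split=> u c a a'; rewrite ?lin_tensor_r ?lin_tensor_l t3l.
  have b2 a : bilin (fun y z => t3 (t a y) z).
    split=> u; first exact: t3r.
    by move=> c y y'; rewrite lin_tensor_r t3l.
  have := congr1 (tlift t3 G3) (coass x).
  have [lG3 G3E] := tlift_spec t3P bG3.
  rewrite !tlift_Delta.
  + rewrite !(lin_sum _ _ _ lG3) /conv => e.
    transitivity (\sum_(p <- coprod_seq x) tlift t3 G3
        (tlift t (fun y z => t3 (t y z) p.2) (Delta p.1))).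
      apply: eq_bigr => p _.
      rewrite tlift_Delta // (lin_sum _ _ _ lG3) mulr_suml; apply: eq_bigr => q _.
      by rewrite G3E /G3 tliftE.
    rewrite e; apply: eq_bigr => p _.
    rewrite tlift_Delta // (lin_sum _ _ _ lG3) mulr_sumr; apply: eq_bigr => q _.
    by rewrite G3E /G3 tliftE // mulrA.
  + split=> u; first by apply: (lin_comp _ linDelta); apply: lin_tlift.
    move=> c a a'; rewrite !tlift_Delta //; rewrite scaler_sumr -big_split.
    by apply: eq_bigr => q _; rewrite lin_tensor_l t3l.
  + split=> u; last by apply: (lin_comp _ linDelta); apply: lin_tlift.
    move=> c a a'; rewrite !tlift_Delta //; rewrite scaler_sumr -big_split.
    by apply: eq_bigr => q _; apply: t3r.
- move=> phi psi a b l1 l2; rewrite convE // DM /tmul.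
  have b1 a1 a2 : bilin (fun c d => t (a1 * c) (a2 * d)).
    by split=> u c y y'; rewrite mulrDr -scalerAr ?lin_tensor_r ?lin_tensor_l.
  have lpp := lproj _ _ l1 l2.
  rewrite tlift_Delta.
    rewrite (lin_sum _ _ _ lpp); apply: eq_bigr => p _.
    rewrite tlift_Delta // (lin_sum _ _ _ lpp); apply: eq_bigr => q _.
    by rewrite tliftE.
  split=> u c a1 a2; rewrite !tlift_Delta // scaler_sumr -big_split; apply: eq_bigr => q _.
    by rewrite mulrDl -scalerAl lin_tensor_r.
  by rewrite mulrDl -scalerAl lin_tensor_l.
- move=> phi psi a b l1 l2; rewrite convE // Dbr /tbracket.
  have [brr brl] := brP.
  have b1 a1 a2 : bilin (fun c d => t (br a1 c) (a2 * d) + t (a1 * c) (br a2 d)).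
    split=> u c y y'; rewrite ?brr ?brl mulrDr -scalerAr ?lin_tensor_r ?lin_tensor_l;
      by rewrite scalerDr addrACA.
  have lpp := lproj _ _ l1 l2.
  rewrite tlift_Delta.
    rewrite (lin_sum _ _ _ lpp); apply: eq_bigr => p _.
    rewrite tlift_Delta // (lin_sum _ _ _ lpp); apply: eq_bigr => q _.
    by rewrite linD // !tliftE.
  split=> u c a1 a2; rewrite !tlift_Delta // scaler_sumr -big_split; apply: eq_bigr => q _.
    by rewrite mulrDl -scalerAl brl !lin_tensor_r /= scalerDr addrACA.
  by rewrite mulrDl -scalerAl brl !lin_tensor_l /= scalerDr addrACA.
- split=> //=; first by rewrite eps1 scale1r.
  by move=> a b; rewrite epsM -scalerAl mul1r scalerA.
- by exists eps.
- apply: functional_extensionality => x; rewrite /conv -[RHS]cul tlift_Delta.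
    by apply: eq_bigr => p _; rewrite mulr_algl.
  split=> u c y y'; rewrite ?leps; first by rewrite scalerDr !scalerA mulrC.
  by rewrite scalerDl scalerA.
- apply: functional_extensionality => x; rewrite /conv -[RHS]cur tlift_Delta.
    by apply: eq_bigr => p _; rewrite mulr_algr.
  split=> u c y y'; rewrite ?leps; last by rewrite scalerDr !scalerA mulrC.
  by rewrite scalerDl scalerA.
- by apply: functional_extensionality => x; rewrite convE.
- by apply: functional_extensionality => x; rewrite convE.
Qed.

End HopfSweedler.

Lemma bracket_antisym (K : fieldType) (A : comAlgType K) (br : A -> A -> A) :
  poisson_bracket br -> forall x z, br x z = - br z x.
Proof.
move=> [[Br Bl] bid _ _] x z; have := bid (x + z).
rewrite (linD _ _ (Bl _)) !(linD _ _ (Br _)) !bid add0r addr0.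
by move/eqP; rewrite addr_eq0 => /eqP.
Qed.

Lemma bracket_leibniz_r (K : fieldType) (A : comAlgType K) (br : A -> A -> A) :
  poisson_bracket br -> forall a b c, br a (b * c) = b * br a c + br a b * c.
Proof.
move=> brP a b c; have [_ _ _ bl] := brP.
by rewrite ![br a _](bracket_antisym brP) bl opprD mulrN mulNr.
Qed.

(** * Antipode, invariant derivations and the bracket *)

Section Convolution.
Variables (K : fieldType) (A : comAlgType K) (br : A -> A -> A).

Definition scalar_valued (phi : A -> A) : Prop :=
  exists e : A -> K, forall a, phi a = (e a)%:A.

Lemma scalar_conv dl phi psi :
  scalar_valued phi -> scalar_valued psi -> scalar_valued (conv dl phi psi).
Proof.
move=> [e eE] [f fE]; exists (fun a => \sum_(p <- dl a) e p.1 * f p.2) => a.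
rewrite /conv scaler_suml; apply: eq_bigr => p _.
by rewrite eE fE mulr_algl scalerA.
Qed.

Lemma algmor_id : algmor (fun a : A => a).
Proof. by []. Qed.

Lemma algmor_comp (phi psi : A -> A) :
  algmor phi -> algmor psi -> algmor (fun a => phi (psi a)).
Proof.
move=> [l1 e1 m1] [l2 e2 m2]; split; first exact: lin_comp.
  by rewrite e2.
by move=> a b; rewrite m2 m1.
Qed.

Lemma algmor_scalar (phi : A -> A) (c : K) : algmor phi -> phi c%:A = c%:A.
Proof. by case=> l1 e1 _; rewrite linZ // e1. Qed.

Lemma eq_algmor_der (chi chi' X : A -> A) :
  chi = chi' -> deriv_along chi X -> deriv_along chi' X.
Proof. by move->. Qed.

Lemma der_one (chi X : A -> A) : algmor chi -> deriv_along chi X -> X 1 = 0.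
Proof.
move=> [_ e1 _] [_ dX]; have := dX 1 1; rewrite mulr1 e1 mulr1 mul1r.
by move/eqP; rewrite -subr_eq0 opprD addrA subrr sub0r oppr_eq0 => /eqP.
Qed.

Variables (dl : A -> seq (A * A)) (eps S : A -> A).
Hypothesis H : sweedler br dl eps S.
Local Notation "f ** g" := (conv dl f g) (at level 40, left associativity).

Let le : lin eps. Proof. by case: (sw_eps H). Qed.
Let lS : lin S. Proof. exact: sw_linS H. Qed.

Lemma conv_mulr_fun phi psi c a : (phi ** (fun x => psi x * c)) a = (phi ** psi) a * c.
Proof. by rewrite /conv mulr_suml; apply: eq_bigr => p _; rewrite mulrA. Qed.

Lemma conv_sumr (I : Type) (r : seq I) phi (psi : I -> A -> A) a :
  (phi ** (fun x => \sum_(i <- r) psi i x)) a = \sum_(i <- r) (phi ** psi i) a.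
Proof.
rewrite /conv exchange_big /=; apply: eq_bigr => p _; exact: mulr_sumr.
Qed.

Lemma conv_eps_l phi : lin phi -> eps ** phi = phi.
Proof.
move=> l1; apply: functional_extensionality => a.
rewrite -[in RHS](_ : (eps ** id) a = a); last by rewrite (sw_eps1 H).
have [e eE] := sw_epsK H.
rewrite /conv (lin_sum _ _ _ l1); apply: eq_bigr => p _.
by rewrite eE !mulr_algl linZ.
Qed.

Lemma conv_eps_r phi : lin phi -> phi ** eps = phi.
Proof.
move=> l1; apply: functional_extensionality => a.
rewrite -[in RHS](_ : (id ** eps) a = a); last by rewrite (sw_1eps H).
have [e eE] := sw_epsK H.
rewrite /conv (lin_sum _ _ _ l1); apply: eq_bigr => p _.
by rewrite eE !mulr_algr linZ.
Qed.

(** Multiplicativity of the coproduct carries the Leibniz rule of [X] over to the convolution.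
    Invariant fields arise from it with [phi] the identity. *)
Lemma der_conv phi psi X : algmor phi -> algmor psi -> deriv_along psi X ->
  deriv_along (phi ** psi) (phi ** X).
Proof.
move=> [l1 e1 m1] [l2 e2 m2] [lX dX]; split; first exact: (sw_lin H).
move=> a b; rewrite (sw_mul H) // /conv !mulr_suml -big_split; apply: eq_bigr => p _.
rewrite /= !mulr_sumr -big_split; apply: eq_bigr => q _ /=.
by rewrite m1 dX; ring.
Qed.

Lemma algmor_antipode : algmor S.
Proof.
have [_ e1 em] := sw_eps H.
split=> //.
  have := sw_one H lS (@lin_id _ A); rewrite (sw_S1 H) e1.
  by rewrite mulr1.
(* Cancel the second factor of Delta a, then that of Delta b. *)
have step a b : \sum_(q <- dl b) S (a * q.1) * q.2 = eps b * S a.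
  pose F x := \sum_(q <- dl b) S (x * q.1) * q.2.
  have lF : lin F.
    apply: lin_bigsum => q; apply: lin_mulr; apply: lin_comp lS _.
    by apply: lin_mulr; apply: lin_id.
  have FE : F ** id = fun x => eps b * eps x.
    apply: functional_extensionality => x.
    rewrite mulrC -em -(sw_S1 H) (sw_mul H) //; apply: eq_bigr => p _.
    by rewrite /F mulr_suml; apply: eq_bigr => q _; ring.
  have: F ** id ** S = F by rewrite (sw_assoc H) // (sw_1S H) conv_eps_r.
  move=> /(congr1 (fun f => f a)); rewrite FE -/(F a) => <-.
  transitivity (eps b * (eps ** S) a); last by rewrite conv_eps_l.
  by rewrite /conv mulr_sumr; apply: eq_bigr => p _; rewrite mulrA.
move=> a b.
pose F x := S (a * x).
have lF : lin F by apply: lin_comp lS _; apply: lin_mull; apply: lin_id.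
have FE : F ** id = fun x => eps x * S a.
  by apply: functional_extensionality => x; rewrite -step.
have: F ** id ** S = F by rewrite (sw_assoc H) // (sw_1S H) conv_eps_r.
move=> /(congr1 (fun f => f b)); rewrite FE -/(F b) => <-.
transitivity (S a * (eps ** S) b); last by rewrite conv_eps_l.
by rewrite /conv mulr_sumr; apply: eq_bigr => p _; rewrite mulrCA mulrA.
Qed.

Lemma conv2_scalar_r (B : A -> A -> A) alpha beta a b : bilin B ->
  scalar_valued alpha -> scalar_valued beta ->
  \sum_(p <- dl a) \sum_(q <- dl b) B p.1 q.1 * (alpha p.2 * beta q.2)
  = B ((id ** alpha) a) ((id ** beta) b).
Proof.
move=> [Br Bl] [e eE] [f fE].
rewrite /conv (lin_sum _ _ _ (Bl _)); apply: eq_bigr => p _.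
rewrite (lin_sum _ _ _ (Br _)); apply: eq_bigr => q _.
rewrite eE fE !mulr_algr (linZ _ _ (Bl _)) (linZ _ _ (Br _)).
by rewrite -scalerAr mulr_algr !scalerA mulrC.
Qed.

Lemma conv2_scalar_l (B : A -> A -> A) alpha beta a b : bilin B ->
  scalar_valued alpha -> scalar_valued beta ->
  \sum_(p <- dl a) \sum_(q <- dl b) (alpha p.1 * beta q.1) * B p.2 q.2
  = B ((alpha ** id) a) ((beta ** id) b).
Proof.
move=> [Br Bl] [e eE] [f fE].
rewrite /conv (lin_sum _ _ _ (Bl _)); apply: eq_bigr => p _.
rewrite (lin_sum _ _ _ (Br _)); apply: eq_bigr => q _.
by rewrite eE fE !mulr_algl (linZ _ _ (Bl _)) (linZ _ _ (Br _)) -scalerAl mulr_algl.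
Qed.

Hypothesis brP : poisson_bracket br.

Let bb : bilin br. Proof. by case: brP. Qed.

Lemma bilin_comp (phi : A -> A) : lin phi -> bilin (fun a b => phi (br a b)).
Proof. by move=> l1; split=> u; apply: lin_comp l1 _; apply bb. Qed.

(** As [eps ** eps] is [eps], each of the two terms in the coproduct of a bracket contributes
    [eps (br a b)], which therefore equals its own double. *)
Lemma eps_bracket a b : eps (br a b) = 0.
Proof.
have [_ _ em] := sw_eps H.
have epsK := sw_epsK H.
have eqE : id ** eps = id by apply: sw_1eps H.
have eqE1 : eps ** id = id by apply: sw_eps1 H.
have eqE' : eps ** eps = eps by apply: conv_eps_l.
have ebr : eps (br a b) = eps (br a b) + eps (br a b).
  rewrite -[in LHS]eqE' (sw_br H) //.
  under eq_bigr do rewrite big_split /=.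
  rewrite big_split /=; congr (_ + _).
    under eq_bigr do under eq_bigr do rewrite em.
    by rewrite (conv2_scalar_r _ _ (bilin_comp le)) ?eqE.
  under eq_bigr do under eq_bigr do rewrite em.
  by rewrite (conv2_scalar_l _ _ (bilin_comp le)) ?eqE1.
by move/eqP: ebr; rewrite -subr_eq0 opprD addrA subrr sub0r oppr_eq0 => /eqP.
Qed.

Variable o : A -> A.
Hypotheses (oM : algmor o) (oK : scalar_valued o).
Let nu := fun a => o (S a).

Let lo : lin o. Proof. by case: oM. Qed.
Let nuM : algmor nu. Proof. exact: (algmor_comp oM algmor_antipode). Qed.
Let lnu : lin nu. Proof. by case: nuM. Qed.

Lemma o_scalar phi : scalar_valued phi -> forall a, o (phi a) = phi a.
Proof. by move=> [e eE] a; rewrite eE algmor_scalar. Qed.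

Lemma o_conv phi psi a :
  o ((phi ** psi) a) = ((fun x => o (phi x)) ** (fun x => o (psi x))) a.
Proof.
have [_ _ om] := oM.
by rewrite /conv (lin_sum _ _ _ lo); apply: eq_bigr => p _; rewrite om.
Qed.

Lemma conv_nu_o : nu ** o = eps.
Proof.
apply: functional_extensionality => a; rewrite -(o_conv S id) (sw_S1 H).
by rewrite o_scalar //; apply: sw_epsK H.
Qed.

Lemma conv_o_nu : o ** nu = eps.
Proof.
apply: functional_extensionality => a; rewrite -(o_conv id S) (sw_1S H).
by rewrite o_scalar //; apply: sw_epsK H.
Qed.

(** The character [o] need not be the counit. Convolving with [nu], the inverse of the point [o],
    translates tangent vectors at [o] to tangent vectors at [eps]. *)
Definition tangent_at_unit xi := nu ** xi.
Definition invariant_field xi := id ** tangent_at_unit xi.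

Lemma scalar_tangent xi : scalar_valued xi -> scalar_valued (tangent_at_unit xi).
Proof.
move=> xiK; apply: scalar_conv => //.
by have [e eE] := oK; exists (fun a => e (S a)) => a; rewrite /nu eE.
Qed.

Lemma der_tangent xi : deriv_along o xi -> deriv_along eps (tangent_at_unit xi).
Proof. by move=> dxi; apply: eq_algmor_der conv_nu_o (der_conv _ _ _). Qed.

Lemma der_invariant_field xi :
  deriv_along o xi -> deriv_along id (invariant_field xi).
Proof.
move=> dxi; apply: eq_algmor_der (sw_1eps H) (der_conv _ _ (der_tangent dxi)) => //.
exact: sw_eps H.
Qed.

(** Evaluation at [o] turns the factor [id] into [o], which cancels [nu]. *)
Lemma invariant_field_at_o xi : deriv_along o xi -> scalar_valued xi ->
  forall a, o (invariant_field xi a) = xi a.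
Proof.
move=> [lxi _] xiK a; rewrite o_conv.
have -> : (fun x => o (tangent_at_unit xi x)) = tangent_at_unit xi.
  by apply: functional_extensionality => x; rewrite o_scalar //; apply: scalar_tangent.
rewrite -[X in conv _ X _](_ : o = _) // /tangent_at_unit.
by rewrite -(sw_assoc H) // conv_o_nu conv_eps_l.
Qed.

Variables (n : nat) (y : 'I_n -> A) (xi : 'I_n -> A -> A).
Hypotheses (xiM : forall k, deriv_along o (xi k)) (xiK : forall k, scalar_valued (xi k)).
Hypothesis xi_basis : forall Y, deriv_along o Y ->
  forall a, Y a = \sum_k xi k a * Y (y k).

Let lxi k : lin (xi k). Proof. by case: (xiM k). Qed.

(** Translate [Y] to [o] as [o ** Y], expand there by [xi_basis], and translate back by [nu]. *)
Lemma tangent_at_unit_basis Y : deriv_along eps Y ->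
  forall a, Y a = \sum_k tangent_at_unit (xi k) a * (o ** Y) (y k).
Proof.
move=> dY a; have [lY _] := dY.
have doY : deriv_along o (o ** Y).
  by apply: eq_algmor_der (conv_eps_r lo) (der_conv oM (sw_eps H) dY).
rewrite -[in LHS](conv_eps_l lY) -conv_nu_o (sw_assoc H) //.
pose c k := (o ** Y) (y k).
have e : o ** Y = fun x => \sum_k xi k x * c k.
  by apply: functional_extensionality => x; apply: xi_basis.
by rewrite [in LHS]e conv_sumr; apply: eq_bigr => k _; rewrite conv_mulr_fun.
Qed.

(** [S ** X] is a derivation along [eps], so it expands over the tangent vectors at the unit;
    convolving with [id] recovers [X] because [id ** S] is [eps]. *)
Lemma invariant_frame X : deriv_along id X ->
  forall a, X a = \sum_k invariant_field (xi k) a * (o ** (S ** X)) (y k).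
Proof.
move=> dX a; have [lX _] := dX.
have dSX : deriv_along eps (S ** X).
  by apply: eq_algmor_der (sw_S1 H) (der_conv algmor_antipode algmor_id dX).
have lSX : lin (S ** X) by case: dSX.
rewrite -[in LHS](conv_eps_l lX) -(sw_1S H) (sw_assoc H) //.
pose c k := (o ** (S ** X)) (y k).
have e : S ** X = fun x => \sum_k tangent_at_unit (xi k) x * c k.
  by apply: functional_extensionality => x; apply: tangent_at_unit_basis.
by rewrite [in LHS]e conv_sumr; apply: eq_bigr => k _; rewrite conv_mulr_fun.
Qed.

(** After expansion in the first argument, the coefficients [c k b] are again derivations along
    [eps] in [b], so a second expansion applies, with scalar coefficients. *)
Lemma tangent_bider_basis (B : A -> A -> A) : bilin B ->
  (forall a b, exists c : K, B a b = c%:A) ->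
  (forall b, deriv_along eps (B^~ b)) -> (forall a, deriv_along eps (B a)) ->
  exists f : 'I_n -> 'I_n -> K, forall a b, B a b =
    \sum_k \sum_l f k l *: (tangent_at_unit (xi k) a * tangent_at_unit (xi l) b).
Proof.
move=> [Br Bl] BK Bdl Bdr.
pose c k b := (o ** B^~ b) (y k).
have lc k : lin (c k).
  by apply: lin_bigsum => p; apply: lin_mull; apply: Br.
have dc k : deriv_along eps (c k).
  split=> // a b; rewrite /c /conv mulr_sumr mulr_suml -big_split.
  apply: eq_bigr => p _ /=; have [_ ->] := Bdr p.2; ring.
have cK k : scalar_valued (c k).
  have [g gE] : exists g : A -> A -> K, forall a b, B a b = (g a b)%:A.
    exists (fun a b => sval (constructive_indefinite_description _ (BK a b))) => a b.
    by case: constructive_indefinite_description.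
  have [e eE] := oK.
  exists (fun b => \sum_(p <- dl (y k)) e p.1 * g p.2 b) => b.
  rewrite /c /conv scaler_suml; apply: eq_bigr => p _.
  by rewrite eE gE mulr_algl scalerA.
have [f fE] : exists f : 'I_n -> 'I_n -> K, forall k l, (o ** c k) (y l) = (f k l)%:A.
  have h k : exists e : A -> K, forall a, (o ** c k) a = (e a)%:A by apply: scalar_conv.
  exists (fun k l => sval (constructive_indefinite_description _ (h k)) (y l)) => k l.
  by case: constructive_indefinite_description.
exists f => a b; rewrite (tangent_at_unit_basis (Bdl b)); apply: eq_bigr => k _.
rewrite -/(c k b) (tangent_at_unit_basis (dc k)) mulr_sumr; apply: eq_bigr => l _.
by rewrite fE mulr_algr -scalerAr.
Qed.

(* The Lie derivative of the bracket along an invariant field is again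
   invariant: this is the infinitesimal form of multiplicativity. *)
Lemma invariant_field_bracket i :
  exists f : 'I_n -> 'I_n -> K, forall a b,
    invariant_field (xi i) (br a b) =
      br (invariant_field (xi i) a) b + br a (invariant_field (xi i) b)
      + \sum_k \sum_l f k l *: (invariant_field (xi k) a * invariant_field (xi l) b).
Proof.
have [_ _ _ bleib] := brP.
set eta := tangent_at_unit (xi i).
have deta : deriv_along eps eta by apply: der_tangent.
have [leta eM] := deta.
have etaK : scalar_valued eta by apply: scalar_tangent.
(* In the Leibniz rule for [eta] the terms carrying [eps] of a bracket vanish, so [eta (br a b)] is
   a derivation along [eps] in each argument. *)
have [f fE] : exists f : 'I_n -> 'I_n -> K, forall a b, eta (br a b) =
    \sum_k \sum_l f k l *: (tangent_at_unit (xi k) a * tangent_at_unit (xi l) b).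
  have ll b : deriv_along eps (fun a => eta (br a b)).
    split; first by have [_ h] := bilin_comp leta; apply: h.
    move=> a a'; rewrite bleib (linD _ _ leta) !eM !eps_bracket; ring.
  apply: (tangent_bider_basis (bilin_comp leta)) => //.
    by have [e eE] := etaK; move=> a b; exists (e (br a b)).
  move=> a; split; first by have [h _] := bilin_comp leta; apply: h.
  by move=> b b'; rewrite bracket_leibniz_r // (linD _ _ leta) !eM !eps_bracket; ring.
exists f => a b; rewrite /invariant_field (sw_br H) //.
under eq_bigr do rewrite big_split /=.
rewrite big_split /=; congr (_ + _).
  (* In each summand the counit restores one argument, while [eta] makes an invariant field of the
     other. *)
  transitivity (\sum_(p <- dl a) \sum_(q <- dl b) br p.1 q.1 * (eps p.2 * eta q.2)
    + \sum_(p <- dl a) \sum_(q <- dl b) br p.1 q.1 * (eta p.2 * eps q.2)).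
    rewrite -big_split; apply: eq_bigr => p _; rewrite -big_split; apply: eq_bigr => q _.
    by rewrite -/eta eM mulrDr.
  rewrite !conv2_scalar_r //; try exact: sw_epsK H.
  by rewrite (sw_1eps H) addrC.
rewrite -/eta; under eq_bigr do under eq_bigr do rewrite fE mulr_sumr.
under eq_bigr do rewrite exchange_big.
rewrite exchange_big; apply: eq_bigr => k _ /=.
under eq_bigr do under eq_bigr do rewrite mulr_sumr.
under eq_bigr do rewrite exchange_big.
rewrite exchange_big; apply: eq_bigr => l _ /=.
rewrite /conv mulr_suml scaler_sumr; apply: eq_bigr => p _.
rewrite mulr_sumr scaler_sumr; apply: eq_bigr => q _.
by rewrite -scalerAr mulrACA.
Qed.

End Convolution.

(** * Derivations of products and determinants *)

Section DerivDet.
Variables (K : fieldType) (A : comAlgType K) (X : A -> A).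
Hypothesis dX : deriv_along id X.

Let lX : lin X. Proof. by case: dX. Qed.

Lemma deriv_prod (I : eqType) (r : seq I) (F : I -> A) : uniq r ->
  X (\prod_(i <- r) F i) = \sum_(i <- r) X (F i) * \prod_(j <- r | j != i) F j.
Proof.
elim: r => [_|i r IH /= /andP [nir ur]].
  by rewrite !big_nil (der_one _ dX).
rewrite !big_cons eqxx /= (proj2 dX) IH // addrC; congr (_ + _).
  congr (_ * _); rewrite [RHS]big_seq_cond [LHS]big_seq; apply: eq_bigl => j.
  by case: eqP => [->|_]; rewrite ?andbT // (negbTE nir).
rewrite mulr_sumr [LHS]big_seq [RHS]big_seq; apply: eq_bigr => j jr.
rewrite big_cons; case: eqP => [e|_]; first by rewrite e jr in nir.
by rewrite mulrCA.
Qed.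

(** Jacobi's formula: in [N i] the row [i] is differentiated, and its determinant is expanded along
    that row. *)
Lemma deriv_det n (M : 'M[A]_n) :
  X (\det M) = \sum_i \sum_j X (M i j) * cofactor M i j.
Proof.
pose N i : 'M[A]_n := \matrix_(k, j) if k == i then X (M i j) else M k j.
transitivity (\sum_i \det (N i)); last first.
  apply: eq_bigr => i _; rewrite (expand_det_row _ i); apply: eq_bigr => j _.
  rewrite mxE eqxx; congr (_ * _); rewrite /cofactor; congr (_ * \det _).
  apply/matrixP => k l; rewrite !mxE.
  by rewrite [_ == i]eq_sym (negbTE (neq_lift _ _)).
rewrite /determinant (lin_sum _ _ _ lX) exchange_big; apply: eq_bigr => s _.
rewrite /= -mulr_sumr.
transitivity ((-1) ^+ odd_perm s * X (\prod_i M i (s i))).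
  case: odd_perm; last by rewrite !expr0 !mul1r.
  by rewrite !expr1 !mulN1r -!scaleN1r linZ.
congr (_ * _); rewrite deriv_prod ?index_enum_uniq //; apply: eq_bigr => i _.
rewrite [RHS](bigD1 i) //= mxE eqxx; congr (_ * _).
by apply: eq_bigr => j ji; rewrite mxE (negbTE ji).
Qed.

End DerivDet.

(** * Divergence of Hamiltonian derivations in invariant frames *)

Section Unimodular.
Variables (K : fieldType) (A : comAlgType K) (br : A -> A -> A).
Hypothesis brP : poisson_bracket br.
Variables (n : nat) (y : 'I_n -> A) (D : 'I_n -> A -> A).
Hypothesis Dy : forall k j, D k (y j) = (k == j)%:R.
Hypothesis y_basis : forall X, deriv_along id X ->
  forall a, X a = \sum_k D k a * X (y k).
Hypothesis unit_scalar : forall u v : A, u * v = 1 -> exists c : K, u = c%:A.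
Variable o : A -> A.
Hypotheses (oM : algmor o) (o_br : forall a b, o (br a b) = 0).

(** With [D j] the partial derivative along [y j], this is the divergence for the coordinate volume
    form; at [br a] it is the modular derivation of [a]. *)
Definition divergence (X : A -> A) := \sum_j D j (X (y j)).

Hypothesis o_div : forall a, o (divergence (br a)) = 0.

Let bb : bilin br. Proof. by case: brP. Qed.
Let lo : lin o. Proof. by case: oM. Qed.
Let om a b : o (a * b) = o a * o b. Proof. by case: oM. Qed.

Let der_br a : deriv_along id (br a).
Proof.
by split; [apply: (proj1 bb) | move=> b c; rewrite bracket_leibniz_r].
Qed.

Let der_brl a : deriv_along id (br^~ a).
Proof. by split; [apply: (proj2 bb) | move=> b c; have [_ _ _ ->] := brP]. Qed.

Section Frame.
Variables (R : 'I_n -> A -> A) (c : 'I_n -> 'I_n -> A).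
Variable f : 'I_n -> 'I_n -> 'I_n -> K.
Hypothesis R_frame : forall j a, D j a = \sum_i R i a * c j i.
Hypothesis R_br : forall i a b, R i (br a b) = br (R i a) b + br a (R i b)
  + \sum_k \sum_l f i k l *: (R k a * R l b).
Hypothesis o_R : forall i a, o (R i a) = o (D i a).

Let M : 'M[A]_n := \matrix_(i, j) R i (y j).
Let C : 'M[A]_n := \matrix_(j, i) c j i.

Lemma frame_mulVmx : C *m M = 1%:M.
Proof.
apply/matrixP => j k; rewrite !mxE -Dy R_frame; apply: eq_bigr => i _.
by rewrite !mxE mulrC.
Qed.

Lemma frame_mulmxV : M *m C = 1%:M.
Proof. exact: mulmx1C frame_mulVmx. Qed.

(* [det M] is a unit, hence a scalar, so its logarithmic derivative vanishes. *)
Lemma frame_trace0 X : deriv_along id X ->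
  \sum_i \sum_j X (R i (y j)) * c j i = 0.
Proof.
move=> dX; have := deriv_det dX M.
have dM : \det C * \det M = 1 by rewrite -det_mulmx frame_mulVmx det1.
have [e ->] : exists e : K, \det M = e%:A.
  by apply: (unit_scalar (v := \det C)); rewrite mulrC.
rewrite (linZ _ _ (proj1 dX)) (der_one _ dX) // scaler0.
have adjE : \adj M = \det M *: C.
  by rewrite -[\adj M]mul1mx -frame_mulVmx -mulmxA mul_mx_adj mul_mx_scalar.
move=> /(congr1 (fun z => \det C * z)); rewrite mulr0 => e0; rewrite [RHS]e0.
rewrite mulr_sumr; apply: eq_bigr => i _; rewrite mulr_sumr; apply: eq_bigr => j _.
have -> : cofactor M i j = \adj M j i by rewrite mxE.
rewrite adjE !mxE; transitivity (X (R i (y j)) * c j i * (\det C * \det M)).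
  by rewrite dM mulr1.
ring.
Qed.

(** Moving [R i] inside the bracket leaves a trace, zero by [frame_trace0], and a constant
    combination of the [R k a], whose constants are found to be 0 by evaluation at [o]. *)
Lemma divergence_frame a :
  divergence (br a) = \sum_i \sum_j br (R i a) (y j) * c j i.
Proof.
(* Contracting the last index of [f i] against [M *m C], the identity, leaves these diagonal
   sums. *)
pose x0 k := \sum_i f i k i.
have main b : divergence (br b) =
    \sum_i \sum_j br (R i b) (y j) * c j i + \sum_k x0 k *: R k b.
  have -> : divergence (br b) = \sum_i \sum_j R i (br b (y j)) * c j i.
    by rewrite exchange_big; apply: eq_bigr => j _; rewrite R_frame.
  rewrite -[RHS]addr0 -[X in _ = _ + X](frame_trace0 (der_br b)).
  have -> : \sum_k x0 k *: R k b = \sum_i \sum_j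
      (\sum_k \sum_l f i k l *: (R k b * R l (y j))) * c j i.
    under eq_bigr do rewrite scaler_suml.
    rewrite exchange_big; apply: eq_bigr => i _ /=.
    under [RHS]eq_bigr do rewrite mulr_suml.
    rewrite [RHS]exchange_big; apply: eq_bigr => k _ /=.
    under [RHS]eq_bigr do rewrite mulr_suml.
    rewrite [RHS]exchange_big (bigD1 i) //= [X in _ + X]big1 ?addr0.
      transitivity (f i k i *: (R k b * (M *m C) i i)).
        by rewrite frame_mulmxV mxE eqxx mulr1.
      rewrite mxE mulr_sumr scaler_sumr; apply: eq_bigr => j _.
      by rewrite !mxE -scalerAl mulrA.
    move=> l li; transitivity (f i k l *: (R k b * (M *m C) l i)).
      rewrite mxE mulr_sumr scaler_sumr; apply: eq_bigr => j _.
      by rewrite !mxE -scalerAl mulrA.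
    by rewrite frame_mulmxV mxE (negbTE li) mulr0 scaler0.
  rewrite -!big_split; apply: eq_bigr => i _; rewrite -!big_split.
  by apply: eq_bigr => j _; rewrite /= R_br; ring.
rewrite main [X in _ + X]big1 ?addr0 // => k _.
(* At [y k] the constant combination evaluates to [x0 k] at [o], whereas the divergence and the
   brackets evaluate to 0. *)
have := o_div (y k); rewrite main (linD _ _ lo) !(lin_sum _ _ _ lo).
rewrite big1 ?add0r => [|i _]; last first.
  by rewrite (lin_sum _ _ _ lo) big1 // => j _; rewrite om o_br mul0r.
have [_ o1 _] := oM.
rewrite (bigD1 k) //= big1 ?addr0 => [|i ik].
  rewrite (linZ _ _ lo) o_R Dy eqxx o1 => /eqP; rewrite scaler_eq0 oner_eq0 orbF.
  by move=> /eqP ->; rewrite scale0r.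
by rewrite (linZ _ _ lo) o_R Dy (negbTE ik) (lin0 lo) scaler0.
Qed.

End Frame.

Variables (L R : 'I_n -> A -> A) (cL cR : 'I_n -> 'I_n -> A).
Variables fL fR : 'I_n -> 'I_n -> 'I_n -> K.
Hypothesis L_frame : forall j a, D j a = \sum_i L i a * cL j i.
Hypothesis R_frame : forall j a, D j a = \sum_i R i a * cR j i.
Hypothesis L_br : forall i a b, L i (br a b) = br (L i a) b + br a (L i b)
  + \sum_k \sum_l fL i k l *: (L k a * L l b).
Hypothesis R_br : forall i a b, R i (br a b) = br (R i a) b + br a (R i b)
  + \sum_k \sum_l fR i k l *: (R k a * R l b).
Hypothesis o_L : forall i a, o (L i a) = o (D i a).
Hypothesis o_R : forall i a, o (R i a) = o (D i a).
Hypothesis LR_comm : forall i j a, L i (R j a) = R j (L i a).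
Hypothesis two_neq0 : (2%:R : K) != 0.

(* Expanding one argument of the bracket along [L] and the other along [R],
   the two expressions of the divergence are opposite to each other. *)
Theorem hamiltonian_divergence0 a : divergence (br a) = 0.
Proof.
have sum0 : divergence (br a) + divergence (br a) = 0.
  rewrite {1}(divergence_frame R_frame R_br o_R) (divergence_frame L_frame L_br o_L).
  have expand (F : 'I_n -> A -> A) c :
      (forall j b, D j b = \sum_i F i b * c j i) -> forall b j,
      br b (y j) = \sum_k \sum_p F k b * c p k * br (y p) (y j).
    move=> FE b j; rewrite (y_basis (der_brl (y j))) exchange_big.
    by apply: eq_bigr => p _; rewrite FE mulr_suml.
  have -> : \sum_i \sum_j br (R i a) (y j) * cR j i =
      \sum_i \sum_k \sum_j \sum_p L k (R i a) * cL p k * br (y p) (y j) * cR j i.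
    apply: eq_bigr => i _; rewrite exchange_big; apply: eq_bigr => j _.
    rewrite (expand _ _ L_frame) mulr_suml; apply: eq_bigr => k _.
    exact: mulr_suml.
  have -> : \sum_k \sum_p br (L k a) (y p) * cL p k =
      \sum_i \sum_k \sum_j \sum_p R i (L k a) * cR j i * br (y j) (y p) * cL p k.
    rewrite [RHS]exchange_big; apply: eq_bigr => k _.
    under [RHS]eq_bigr do rewrite exchange_big.
    rewrite [RHS]exchange_big; apply: eq_bigr => p _.
    rewrite (expand _ _ R_frame) mulr_suml; apply: eq_bigr => i _.
    exact: mulr_suml.
  (* The two sums cancel term by term. *)
  rewrite -big_split big1 // => i _; rewrite -big_split big1 // => k _.
  rewrite -big_split big1 // => j _; rewrite -big_split big1 // => p _ /=.
  by rewrite LR_comm (bracket_antisym brP (y p) (y j)); ring.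
have: (2%:R : K) *: divergence (br a) = 0 by rewrite scaler_nat mulr2n.
by move/eqP; rewrite scaler_eq0 (negbTE two_neq0) => /eqP.
Qed.

End Unimodular.

(** * Homogeneous components, the origin and its cotangent space *)

Section Grading.
Variables (K : fieldType) (A : comAlgType K) (G : nat -> A -> Prop).
Hypothesis GP : connected_graded G.

Let G0 i : G i 0. Proof. by case: GP => /(_ i) []. Qed.
Let Glin i (c : K) x z : G i x -> G i z -> G i (c *: x + z).
Proof. by case: GP => /(_ i) [_ h] _ _ _ _; apply: h. Qed.
Let GD i x z : G i x -> G i z -> G i (x + z).
Proof. by move=> h1 h2; rewrite -[x]scale1r; apply: Glin. Qed.
Let GM i j x z : G i x -> G j z -> G (i + j)%N (x * z).
Proof. by case: GP => _ _ _ h _; apply: h. Qed.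

(** Storing a decomposition as a polynomial, with value [a] at 1, makes products of decompositions
    products in [{poly A}]. *)
Lemma graded_poly_exists a : exists p : {poly A}, (forall i, G i p`_i) /\ p.[1] = a.
Proof.
have [_ /(_ a) [N [c [cG ->]]] _ _ _] := GP.
exists (\poly_(i < N) c i); split=> [i|]; first by rewrite coef_poly; case: ifP.
rewrite horner_poly; apply: eq_bigr => i _; by rewrite expr1n mulr1.
Qed.

(* The coefficients of [gr a] are the homogeneous components of [a]. *)
Definition gr a : {poly A} :=
  sval (constructive_indefinite_description _ (graded_poly_exists a)).

Lemma grG a i : G i (gr a)`_i.
Proof. by rewrite /gr; case: constructive_indefinite_description => p []. Qed.

Lemma gr_horner a : (gr a).[1] = a.
Proof. by rewrite /gr; case: constructive_indefinite_description => p []. Qed.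

Lemma gr_sum a : a = \sum_(i < size (gr a)) (gr a)`_i.
Proof.
rewrite -{1}[a]gr_horner horner_coef; apply: eq_bigr => i _.
by rewrite expr1n mulr1.
Qed.

Lemma gr_unique (p : {poly A}) a : (forall i, G i p`_i) -> p.[1] = a -> gr a = p.
Proof.
move=> pG pa; apply/eqP; rewrite -subr_eq0; apply/eqP.
set q := gr a - p.
have qG i : G i q`_i.
  by rewrite coefB addrC -scaleN1r; apply: Glin; [apply: pG | apply: grG].
have q0 : \sum_(i < size q) q`_i = 0.
  transitivity q.[1]; last by rewrite hornerD hornerN gr_horner pa subrr.
  by rewrite horner_coef; apply: eq_bigr => i _; rewrite expr1n mulr1.
have [_ _ h _ _] := GP; have {}h := h _ (fun i => q`_i) qG q0.
apply/polyP => i; rewrite coef0; case: (ltnP i (size q)); first exact: h.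
exact: nth_default.
Qed.

Lemma gr_lin (c : K) a b i : (gr (c *: a + b))`_i = c *: (gr a)`_i + (gr b)`_i.
Proof.
have -> : gr (c *: a + b) = (c%:A)%:P * gr a + gr b.
  apply: gr_unique => [j|].
    by rewrite coefD coefCM mulr_algl; apply: Glin; apply: grG.
  by rewrite hornerD hornerM hornerC !gr_horner mulr_algl.
by rewrite coefD coefCM mulr_algl.
Qed.

Lemma lin_gr i : lin (fun a => (gr a)`_i).
Proof. by move=> c a b; apply: gr_lin. Qed.

Lemma grM a b : gr (a * b) = gr a * gr b.
Proof.
apply: gr_unique => [i|]; last by rewrite hornerM !gr_horner.
rewrite coefM; elim/big_ind: _ => [||j _] //; first exact: GD.
by rewrite -[i in G i](@subnKC j) ?(leq_ord j) //; apply: GM; apply: grG.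
Qed.

Lemma gr_homog i a j : G i a -> (gr a)`_j = if j == i then a else 0.
Proof.
move=> Ga; rewrite (@gr_unique (a *: 'X^i) a).
- by rewrite coefZ coefXn; case: eqP; rewrite ?mulr1 ?mulr0.
- by move=> k; rewrite coefZ coefXn; case: eqP => [->|_]; rewrite ?mulr1 ?mulr0.
- by rewrite hornerZ hornerXn expr1n mulr1.
Qed.

Definition origin a := (gr a)`_0.

Lemma origin_scalar : scalar_valued origin.
Proof.
have [_ _ _ _ h] := GP.
have h' a : exists c : K, origin a = c%:A by apply/h; apply: grG.
exists (fun a => sval (constructive_indefinite_description _ (h' a))) => a.
by case: constructive_indefinite_description.
Qed.

Let G1 : G 0 1.
Proof. by have [_ _ _ _ h] := GP; apply/h; exists 1; rewrite scale1r. Qed.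

Lemma algmor_origin : algmor origin.
Proof.
split; first exact: lin_gr.
  by rewrite /origin (gr_homog _ G1).
by move=> a b; rewrite /origin grM coef0M.
Qed.

Lemma lin_origin : lin origin. Proof. exact: lin_gr. Qed.

Lemma origin_homog i a : G i a -> (0 < i)%N -> origin a = 0.
Proof. by move=> Ga i0; rewrite /origin (gr_homog _ Ga); case: i i0 {Ga}. Qed.

Lemma homog0_scalar a : G 0 a -> exists c : K, a = c%:A.
Proof. by have [_ _ _ _ h] := GP; move/h. Qed.

Lemma homog_ind (P : A -> Prop) :
  (forall x z, P x -> P z -> P (x + z)) -> P 0 ->
  (forall i a, G i a -> P a) -> forall a, P a.
Proof.
move=> PD P0 PG a; rewrite [a]gr_sum; elim/big_ind: _ => [||i _] //.
exact: PG (grG a i).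
Qed.

Section Bracket.
Variables (br : A -> A -> A) (d : nat).
Hypotheses (brP : poisson_bracket br) (brG : bracket_homogeneous G br d).

Let bb : bilin br. Proof. by case: brP. Qed.

Lemma bracket_scalar (c : K) b : br c%:A b = 0.
Proof.
have [_ _ _ bl] := brP.
rewrite (linZ _ _ (proj2 bb b)).
by rewrite (@der_one _ _ id (br^~ b)) ?scaler0 //; split=> [|x z]; [apply: (proj2 bb) | rewrite bl].
Qed.

(** Scalars have zero bracket; for [a] of positive degree the bracket has positive degree, since [d]
    is nonnegative. *)
Lemma origin_bracket a b : origin (br a b) = 0.
Proof.
have [Br Bl] := bb; have lo := lin_origin.
elim/homog_ind: a => [x z hx hz||i a Ga].
- by rewrite (linD _ _ (Bl _)) (linD _ _ lo) hx hz addr0.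
- by rewrite (lin0 (Bl b)) (lin0 lo).
case: i Ga => [/homog0_scalar [c ->]|i Ga]; first by rewrite bracket_scalar (lin0 lo).
elim/homog_ind: b => [x z hx hz||j b Gb].
- by rewrite (linD _ _ (Br _)) (linD _ _ lo) hx hz addr0.
- by rewrite (lin0 (Br a)) (lin0 lo).
exact: origin_homog (brG Ga Gb) _.
Qed.

End Bracket.

(** Membership in the square of the maximal ideal, the kernel of [origin]. *)
Definition max_sq (a : A) : Prop := exists s : seq (A * A),
  (forall p, p \in s -> origin p.1 = 0 /\ origin p.2 = 0)
  /\ a = \sum_(p <- s) p.1 * p.2.

Lemma max_sq0 : max_sq 0.
Proof. by exists [::]; rewrite big_nil. Qed.

Lemma max_sqM u v : origin u = 0 -> origin v = 0 -> max_sq (u * v).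
Proof.
move=> hu hv; exists [:: (u, v)]; rewrite big_seq1; split=> // p.
by rewrite inE => /eqP ->.
Qed.

Lemma max_sqD a b : max_sq a -> max_sq b -> max_sq (a + b).
Proof.
move=> [s [hs ->]] [s' [hs' ->]]; exists (s ++ s'); rewrite big_cat; split=> // p.
by rewrite mem_cat => /orP []; [apply: hs | apply: hs'].
Qed.

Lemma max_sqZ (c : K) a : max_sq a -> max_sq (c *: a).
Proof.
move=> [s [hs ->]]; exists [seq (c *: p.1, p.2) | p <- s]; split.
  move=> p /mapP [q /hs [h1 h2] ->] /=; split=> //.
  by rewrite (linZ _ _ lin_origin) h1 scaler0.
by rewrite big_map scaler_sumr; apply: eq_bigr => p _; rewrite scalerAl.
Qed.

Lemma max_sqB a b : max_sq a -> max_sq b -> max_sq (a - b).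
Proof. by move=> ha hb; apply: max_sqD => //; rewrite -scaleN1r; apply: max_sqZ. Qed.

Lemma max_sq_sum (I : Type) (r : seq I) (F : I -> A) :
  (forall i, max_sq (F i)) -> max_sq (\sum_(i <- r) F i).
Proof. by move=> hF; elim/big_ind: _ => //; [apply: max_sq0 | apply: max_sqD]. Qed.

Lemma origin_gr a i : origin a = 0 -> origin (gr a)`_i = 0.
Proof.
case: i => [a0|i _]; first by rewrite -/(origin a) a0 (lin0 lin_origin).
exact: origin_homog (grG a _) _.
Qed.

Lemma max_sq_gr a i : max_sq a -> max_sq (gr a)`_i.
Proof.
move=> [s [hs ->]]; rewrite (lin_sum _ _ _ (lin_gr i)).
rewrite big_seq; elim/big_ind: _; [exact: max_sq0 | exact: max_sqD |].
move=> p /hs [h1 h2]; rewrite grM coefM; apply: max_sq_sum => j.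
by apply: max_sqM; apply: origin_gr.
Qed.

(** Since [a - origin a] is the part of [a] in the maximal ideal, this is spanning of the cotangent
    space at the origin. *)
Definition cotangent_span n (x : 'I_n -> A) : Prop :=
  forall a, exists c : 'I_n -> K, max_sq (a - origin a - \sum_k c k *: x k).

Definition cotangent_free n (x : 'I_n -> A) : Prop :=
  forall c : 'I_n -> K, max_sq (\sum_k c k *: x k) -> forall k, c k = 0.

Definition positive_homog n (x : 'I_n -> A) (e : 'I_n -> nat) : Prop :=
  forall k, (0 < e k)%N /\ G (e k) (x k).

(** The positive-degree components of the algebra generators suffice, because products within the
    maximal ideal vanish modulo its square. *)
Lemma cotangent_spanning_family : fin_gen_alg A ->
  exists n (x : 'I_n -> A) e, positive_homog x e /\ cotangent_span x.
Proof.
have lo := lin_origin; have [_ o1 om] := algmor_origin; have [oe oE] := origin_scalar.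
move=> [s gen].
(* Degree 0 is left out; the last index [size (gr a)] only adds a zero component. *)
pose L := [seq (i, (gr a)`_i) | a <- s, i <- iota 1 (size (gr a))].
pose x (k : 'I_(size L)) := (tnth (in_tuple L) k).2.
pose e (k : 'I_(size L)) := (tnth (in_tuple L) k).1.
exists (size L), x, e; split.
  move=> k; have := mem_tnth k (in_tuple L); rewrite /e /x.
  case: (tnth _ _) => i a /allpairsPdep [b [j [_]]]; rewrite mem_iota => /andP [j0 _] [-> ->].
  by split=> //; apply: grG.
pose P a := exists c : 'I_(size L) -> K, max_sq (a - origin a - \sum_k c k *: x k).
have P1 : P 1.
  exists (fun=> 0); rewrite o1 subrr big1 ?subrr; first exact: max_sq0.
  by move=> k _; rewrite scale0r.
have Plin (c : K) a b : P a -> P b -> P (c *: a + b).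
  move=> [ca ha] [cb hb]; exists (fun k => c * ca k + cb k).
  have -> : c *: a + b - origin (c *: a + b) - \sum_k (c * ca k + cb k) *: x k =
    c *: (a - origin a - \sum_k ca k *: x k) + (b - origin b - \sum_k cb k *: x k).
    under eq_bigr do rewrite scalerDl -scalerA.
    rewrite big_split /= -scaler_sumr lo !scalerBr; ring.
  by apply: max_sqD => //; apply: max_sqZ.
have Psum (I : Type) (r : seq I) F : (forall i : I, P (F i)) -> P (\sum_(i <- r) F i).
  move=> hF; elim/big_ind: _ => //.
    by have := Plin (-1) _ _ P1 P1; rewrite scaleN1r addNr.
  by move=> a b ha hb; rewrite -[a]scale1r; apply: Plin.
have PX k : P (x k).
  exists (fun j => (j == k)%:R); rewrite (bigD1 k) //= eqxx scale1r big1 ?addr0.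
    suff -> : origin (x k) = 0 by rewrite subr0 subrr; apply: max_sq0.
    have := mem_tnth k (in_tuple L); rewrite /x.
    case: (tnth _ _) => i a /allpairsPdep [b [j [_]]]; rewrite mem_iota => /andP [j0 _] [_ ->].
    exact: origin_homog (grG _ _) j0.
  by move=> j jk; rewrite (negbTE jk) scale0r.
have P0 : P 0 by have := Plin (-1) _ _ P1 P1; rewrite scaleN1r addNr.
have Pc (c : K) : P c%:A by rewrite -[c%:A]addr0; apply: Plin.
apply: gen => //.
  move=> a sa; rewrite [a]gr_sum; apply: Psum => i.
  case: i => [[|i] /= si]; first by rewrite -/(origin a) oE.
  have mL : (i.+1, (gr a)`_i.+1) \in L.
    by apply/allpairsPdep; exists a, i.+1; split=> //=; rewrite mem_iota /= add1n ltnS ltnW.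
  have [k kE] : exists k, tnth (in_tuple L) k = (i.+1, (gr a)`_i.+1).
    by have /tnthP [k ->] : (i.+1, (gr a)`_i.+1) \in in_tuple L by []; exists k.
  by have := PX k; rewrite /x kE.
(* [a * b] minus its value at the origin is [oe a *: v + oe b *: u + u * v], and the last term lies
   in the square. *)
move=> a b [ca ha] [cb hb]; exists (fun k => oe a * cb k + oe b * ca k).
set u := a - origin a; set v := b - origin b.
have -> : a * b - origin (a * b) - \sum_k (oe a * cb k + oe b * ca k) *: x k =
  oe a *: (v - \sum_k cb k *: x k) + oe b *: (u - \sum_k ca k *: x k) + u * v.
  under eq_bigr do rewrite scalerDl -!scalerA.
  have sE w z : oe w *: z = origin w * z by rewrite oE mulr_algl.
  rewrite big_split /= -!scaler_sumr om !sE /u /v; ring.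
apply: max_sqD; last first.
  have oo z : origin (z - origin z) = 0.
    by rewrite (linB _ _ lo) (o_scalar algmor_origin origin_scalar) subrr.
  by apply: max_sqM; apply: oo.
by apply: max_sqD; apply: max_sqZ.
Qed.

(** Induction on the length of a spanning family: a nontrivial relation allows one member to be
    discarded. *)
Lemma cotangent_basis : fin_gen_alg A ->
  exists n (x : 'I_n -> A) e,
    [/\ positive_homog x e, cotangent_span x & cotangent_free x].
Proof.
move=> /cotangent_spanning_family [n [x [e [hx sx]]]].
elim: n x e hx sx => [|n IH] x e hx sx.
  by exists 0%N, x, e; split=> // c _ [].
have [free|nfree] := excluded_middle_informative (cotangent_free x).
  by exists n.+1, x, e.
have [c [hc [k ck]]] : exists c : 'I_n.+1 -> K,
    max_sq (\sum_k c k *: x k) /\ exists k, c k != 0.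
  apply: NNPP => h; apply: nfree => c hc k; apply/eqP; apply/negPn/negP => ck.
  by apply: h; exists c; split=> //; exists k.
apply: (IH (fun j => x (lift k j)) (fun j => e (lift k j))); first by move=> j; apply: hx.
move=> a; have [b hb] := sx a.
(* Subtracting [b k / c k] times the relation eliminates [x k]. *)
exists (fun j => b (lift k j) - b k / c k * c (lift k j)).
have := max_sqD hb (max_sqZ (b k / c k) hc).
rewrite !(bigD1_ord k) //= scalerDr scalerA mulfVK //.
congr max_sq.
under [in RHS]eq_bigr do rewrite scalerBl -scalerA.
rewrite sumrB -scaler_sumr.
set w := \sum_(i < n) _; set v := _ *: \sum_(i < n) _; set z := b k *: _.
ring.
Qed.

End Grading.

(** * Generators and the chain rule for polynomials *)

Section MpolyGen.
Variables (K : fieldType) (n : nat).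

Lemma mpoly_gen_ind (P : {mpoly K[n]} -> Prop) :
  P 1 -> (forall k, P 'X_k) ->
  (forall (c : K) u v, P u -> P v -> P (c *: u + v)) ->
  (forall u v, P u -> P v -> P (u * v)) -> forall p, P p.
Proof.
move=> P1 PX Plin PM.
have P0 : P 0 by have := Plin (-1) _ _ P1 P1; rewrite scaleN1r addNr.
elim/mpolyind => // c m p _ _ Pp; apply: Plin => //.
rewrite mpolyXE_id; elim/big_ind: _ => [||i _] //.
by elim: (m i) => [|k IH]; rewrite ?expr0 // exprS; apply: PM.
Qed.

Lemma mderiv_var (i j : 'I_n) : mderiv i 'X_j = (i == j)%:R :> {mpoly K[n]}.
Proof.
rewrite mderivX mnm1E eq_sym; case: eqP => [->|_]; last by rewrite scale0r.
rewrite scale1r [X in 'X_[X]](_ : _ = 0%MM) ?mpolyX0 //.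
by apply/mnmP => k; rewrite mnmE mnm0E subnn.
Qed.

(** Both sides are derivations along [chi] composed with [phi], hence agree once they agree on the
    variables. *)
Lemma mpoly_chain (A : comAlgType K) (phi : {mpoly K[n]} -> A) (chi Y : A -> A) :
  lin phi -> phi 1 = 1 -> (forall p q, phi (p * q) = phi p * phi q) ->
  algmor chi -> deriv_along chi Y ->
  forall p, Y (phi p) = \sum_j chi (phi (mderiv j p)) * Y (phi 'X_j).
Proof.
move=> lm phi1 phiM chiM dY p; have [lY mY] := dY; have [lc c1 cM] := chiM.
elim/mpoly_gen_ind: p => [|k|c u v hu hv|u v hu hv].
- rewrite phi1 (der_one _ dY) // big1 // => j _.
  by rewrite -[1]mpolyC1 mderivC (lin0 lm) (lin0 lc) mul0r.
- rewrite (bigD1 k) //= mderiv_var eqxx phi1 c1 mul1r big1 ?addr0 // => j jk.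
  by rewrite mderiv_var (negbTE jk) (lin0 lm) (lin0 lc) mul0r.
- rewrite lm lY hu hv scaler_sumr -big_split; apply: eq_bigr => j _ /=.
  by rewrite mderivD mderivZ lm lc mulrDl scalerAl.
- rewrite phiM mY hu hv mulr_sumr mulr_suml -big_split; apply: eq_bigr => j _ /=.
  rewrite mderivM (linD _ _ lm) !phiM (linD _ _ lc) !cM; ring.
Qed.

End MpolyGen.

(** * Homogeneous coordinates and polynomiality *)

Section Coordinates.
Variables (K : fieldType) (A : comAlgType K) (G : nat -> A -> Prop).
Hypothesis GP : connected_graded G.
Local Notation o := (origin GP).
Variables (n : nat) (x : 'I_n -> A) (e : 'I_n -> nat).
Hypotheses (xG : positive_homog G x e) (xspan : cotangent_span GP x)
  (xfree : cotangent_free GP x).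

Definition kcoord (k : 'I_n) (a : A) : K :=
  sval (constructive_indefinite_description _ (xspan a)) k.

Lemma coordP a : max_sq GP (a - o a - \sum_k kcoord k a *: x k).
Proof. by rewrite /kcoord; case: constructive_indefinite_description. Qed.

(** Two expansions differ by a linear relation modulo the square, trivial by [xfree]; this pins down
    the chosen [kcoord]. *)
Lemma coord_unique (c : 'I_n -> K) a :
  max_sq GP (a - o a - \sum_k c k *: x k) -> forall k, kcoord k a = c k.
Proof.
move=> hc k; apply/eqP; rewrite -subr_eq0; apply/eqP.
apply: (xfree (c := fun k => kcoord k a - c k)).
have := max_sqB hc (coordP a); congr max_sq.
under [RHS]eq_bigr do rewrite scalerBl.
rewrite sumrB; ring.
Qed.

Definition cotangent_coord k (a : A) : A := (kcoord k a)%:A.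

Lemma scalar_coord k : scalar_valued (cotangent_coord k).
Proof. by exists (kcoord k). Qed.

Lemma coord_lin k (c : K) a b : kcoord k (c *: a + b) = c * kcoord k a + kcoord k b.
Proof.
apply: (coord_unique (c := fun k => c * kcoord k a + kcoord k b)).
have := max_sqD (max_sqZ c (coordP a)) (coordP b); congr max_sq.
under [in RHS]eq_bigr do rewrite scalerDl -scalerA.
rewrite big_split /= -scaler_sumr (lin_origin GP) !scalerBr; ring.
Qed.

Lemma lin_coord k : lin (cotangent_coord k).
Proof. by move=> c a b; rewrite /cotangent_coord coord_lin scalerDl scalerA. Qed.

Lemma coord_max_sq k a : max_sq GP a -> o a = 0 -> kcoord k a = 0.
Proof.
move=> ha oa; apply: (coord_unique (c := fun=> 0)).
by rewrite oa subr0 big1 ?subr0 // => j _; rewrite scale0r.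
Qed.

Lemma coord_x k j : kcoord k (x j) = (j == k)%:R.
Proof.
apply: (coord_unique (c := fun k => (j == k)%:R)).
have [j0 Gj] := xG j.
rewrite (origin_homog GP Gj j0) subr0 (bigD1 j) //= eqxx scale1r big1 ?addr0.
  by rewrite subrr; apply: max_sq0.
by move=> i ij; rewrite eq_sym (negbTE ij) scale0r.
Qed.

(** A linear form on the cotangent space, extended by 0 to constants, kills the product of [a - o a]
    and [b - o b]; this amounts to the Leibniz rule at [o]. *)
Lemma der_coord k : deriv_along o (cotangent_coord k).
Proof.
have lo := lin_origin GP; have [_ o1 om] := algmor_origin GP.
split; first exact: lin_coord.
have lc := lin_coord k.
have oo a : o (a - o a) = 0.
  by rewrite (linB _ _ lo) (o_scalar (algmor_origin GP) (origin_scalar GP)) subrr.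
have c1 : cotangent_coord k 1 = 0.
  rewrite /cotangent_coord (coord_unique (c := fun=> 0)) ?scale0r //.
  by rewrite o1 subrr big1 ?subrr; [apply: max_sq0 | move=> j _; rewrite scale0r].
have cs : forall a b, cotangent_coord k (o a * b) = o a * cotangent_coord k b.
  by have [oe oE] := origin_scalar GP; move=> a b; rewrite oE !mulr_algl (linZ _ _ lc).
move=> a b.
have co : cotangent_coord k (o a) = 0 by rewrite -[o a]mulr1 cs c1 mulr0.
have cM : cotangent_coord k ((a - o a) * (b - o b)) = 0.
  rewrite /cotangent_coord coord_max_sq ?scale0r //; first by apply: max_sqM.
  by rewrite om oo mul0r.
have -> : a * b = (a - o a) * (b - o b) + (o a * b + o b * (a - o a)) by ring.
rewrite (linD _ _ lc) cM (linD _ _ lc) !cs (linB _ _ lc) co; ring.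
Qed.

Lemma cotangent_coord_basis (Y : A -> A) : deriv_along o Y ->
  forall a, Y a = \sum_k cotangent_coord k a * Y (x k).
Proof.
move=> dY a; have [lY mY] := dY; have [oe oE] := origin_scalar GP.
have Y1 := der_one (algmor_origin GP) dY.
have Ysq z : max_sq GP z -> Y z = 0.
  move=> [s [hs ->]]; rewrite (lin_sum _ _ _ lY) big_seq big1 // => p /hs [h1 h2].
  by rewrite mY h1 h2 mul0r mulr0 addr0.
have := Ysq _ (coordP a); rewrite !(linB _ _ lY) oE (linZ _ _ lY) Y1 scaler0 subr0.
rewrite (lin_sum _ _ _ lY) => /eqP; rewrite subr_eq0 => /eqP ->.
by apply: eq_bigr => k _; rewrite (linZ _ _ lY) mulr_algl.
Qed.

(** The degree [N] component of the expansion of [a] involves only the [x k] of degree [N], and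
    coordinates are unique. *)
Lemma coord_homog N a k : G N a -> N != e k -> kcoord k a = 0.
Proof.
move=> Ga Nk.
suff -> : kcoord k a = (if e k == N then kcoord k a else 0).
  by rewrite eq_sym (negbTE Nk).
apply: (coord_unique (c := fun k => if e k == N then kcoord k a else 0)).
have [[N0|N0] lg] := (posnP N, lin_gr GP N).
  have [c ->] : exists c : K, a = c%:A by apply: (homog0_scalar GP); rewrite -N0.
  rewrite (algmor_scalar c (algmor_origin GP)) subrr sub0r -scaleN1r big1 ?scaler0.
    exact: max_sq0.
  move=> j _; case: eqP => [ej|_]; last by rewrite scale0r.
  by have [] := xG j; rewrite ej N0.
have := max_sq_gr N (coordP a).
rewrite (origin_homog GP Ga N0) subr0 (linB _ _ lg) (gr_homog GP _ Ga) eqxx.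
rewrite (lin_sum _ _ _ lg); congr (max_sq _ (_ - _)); apply: eq_bigr => j _.
rewrite (linZ _ _ lg); have [_ Gj] := xG j; rewrite (gr_homog GP _ Gj) eq_sym.
by case: eqP; rewrite ?scaler0 ?scale0r.
Qed.

(** For [a] of degree [i > 0], the degree [i + e k + d] of [br a (x k)] exceeds [e k], so every
    summand is already 0. *)
Lemma coord_bracket_trace (br : A -> A -> A) (d : nat) a :
  poisson_bracket br -> bracket_homogeneous G br d ->
  \sum_k cotangent_coord k (br a (x k)) = 0.
Proof.
move=> brP brG; have [[_ Bl] _ _ _] := brP.
elim/(homog_ind GP): a => [u v hu hv||i a Ga].
- under eq_bigr do rewrite (linD _ _ (Bl _)) (linD _ _ (lin_coord _)).
  by rewrite big_split /= hu hv addr0.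
- by rewrite big1 // => k _; rewrite (lin0 (Bl _)) (lin0 (lin_coord _)).
rewrite big1 // => k _.
case: i Ga => [/(homog0_scalar GP) [c ->]|i Ga].
  by rewrite (bracket_scalar brP) (lin0 (lin_coord _)).
have [_ Gk] := xG k; rewrite /cotangent_coord (coord_homog (brG _ _ _ _ Ga Gk)) ?scale0r //.
by rewrite neq_ltn !addSn ltnS -addnA addnCA leq_addr orbT.
Qed.

(** Induction on the degree: a homogeneous [a] of positive degree is a combination of the [x k] plus
    products of components of strictly lower degree. *)
Lemma cotangent_generate (P : A -> Prop) :
  P 1 -> (forall k, P (x k)) ->
  (forall (c : K) u v, P u -> P v -> P (c *: u + v)) ->
  (forall u v, P u -> P v -> P (u * v)) -> forall a, P a.
Proof.
move=> P1 Px Plin PM.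
have P0 : P 0 by have := Plin (-1) _ _ P1 P1; rewrite scaleN1r addNr.
have PD u v : P u -> P v -> P (u + v).
  by move=> hu hv; rewrite -[u]scale1r; apply: Plin.
have PZ c u : P u -> P (c *: u) by move=> hu; rewrite -[_ *: _]addr0; apply: Plin.
suff PG N : forall i a, (i < N)%N -> G i a -> P a.
  by elim/(homog_ind GP) => // i a Ga; apply: (PG i.+1 i).
elim: N => // N IH i a; rewrite ltnS leq_eqVlt => /orP [/eqP -> {i}|]; last exact: IH.
have [->|N0] := posnP N; first by move=> /(homog0_scalar GP) [c ->]; apply: PZ.
move=> Ga; have [s [hs sE]] := coordP a; have lg := lin_gr GP N.
have := congr1 (fun z => (gr GP z)`_N) sE => /=.
rewrite (origin_homog GP Ga N0) subr0 (linB _ _ lg) (gr_homog GP _ Ga) eqxx.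
move/eqP; rewrite subr_eq => /eqP ->; apply: (PD); rewrite (lin_sum _ _ _ lg).
  rewrite big_seq; elim/big_ind: _ => [||p /hs [h1 h2]] //.
  rewrite grM coefM; elim/big_ind: _ => [||[i iN] _] //=.
  (* The two extreme terms contain a degree 0 component, which is 0, so both remaining factors have
     degree below [N]. *)
  case: i iN => [|i] iN; first by rewrite -/(o p.1) h1 mul0r.
  have [NE|Ni] := eqVneq N i.+1; first by rewrite NE subnn -/(o p.2) h2 mulr0.
  rewrite ltnS in iN.
  apply: PM; first by apply: IH (grG GP _ _); rewrite ltn_neqAle eq_sym Ni.
  by apply: IH (grG GP _ _); rewrite ltn_subrL.
elim/big_ind: _ => [||k _] //; rewrite (linZ _ _ lg); apply: PZ.
by have [_ Gk] := xG k; rewrite (gr_homog GP _ Gk); case: eqP.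
Qed.

Hypothesis char0 : [pchar K] =i pred0.
Variable X : 'I_n -> A -> A.
Hypotheses (Xder : forall i, deriv_along id (X i))
  (Xx : forall i j, o (X i (x j)) = (i == j)%:R).

Definition coord_map : {mpoly K[n]} -> A := mmap (GRing.in_alg A) x.

Lemma coord_mapX k : coord_map 'X_k = x k.
Proof. by rewrite /coord_map mmapX mmap1U. Qed.

Lemma lin_coord_map : lin coord_map.
Proof. by move=> c p q; rewrite /coord_map mmapD mmapZ /= mulr_algl. Qed.

Lemma coord_map1 : coord_map 1 = 1.
Proof. exact: rmorph1. Qed.

Lemma coord_mapM p q : coord_map (p * q) = coord_map p * coord_map q.
Proof. exact: rmorphM. Qed.

Lemma coord_map_chain i p :
  X i (coord_map p) = \sum_j coord_map (mderiv j p) * X i (x j).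
Proof.
rewrite (mpoly_chain lin_coord_map coord_map1 coord_mapM (algmor_id A) (Xder i)).
by apply: eq_bigr => j _; rewrite coord_mapX.
Qed.

(* Graded Nakayama: the lowest components of the [b j] must vanish. *)
Lemma nakayama (b : 'I_n -> A) :
  (forall i, \sum_j b j * X i (x j) = 0) -> forall j, b j = 0.
Proof.
move=> hb.
have main r : forall s i, (s < r)%N -> (gr GP (b i))`_s = 0.
  elim: r => // r IH s i; rewrite ltnS leq_eqVlt => /orP [/eqP -> {s}|]; last exact: IH.
  have := congr1 (fun z => (gr GP z)`_r) (hb i) => /=.
  rewrite (lin0 (lin_gr GP r)) (lin_sum _ _ _ (lin_gr GP r)) => {2}<-.
  rewrite (bigD1 i) //= [X in _ + X]big1 ?addr0.
    rewrite grM coefM (bigD1 ord_max) //= subnn -/(o (X i (x i))) Xx eqxx mulr1.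
    by rewrite big1 ?addr0 // => s sr; rewrite IH ?mul0r // ltn_neqAle sr -ltnS ltn_ord.
  move=> j ji; rewrite grM coefM (bigD1 ord_max) //= subnn -/(o (X i (x j))) Xx.
  rewrite eq_sym (negbTE ji) mulr0 add0r big1 // => s sr.
  by rewrite IH ?mul0r // ltn_neqAle sr -ltnS ltn_ord.
by move=> j; rewrite [b j](gr_sum GP) big1 // => i _; apply: main (ltnSn _).
Qed.

Lemma mderiv_eq0_const (p : {mpoly K[n]}) :
  (forall i, mderiv i p = 0) -> p = (p@_0)%:MP.
Proof.
move=> hp; apply/mpolyP => m; rewrite mcoeffC.
have [->|] := eqVneq m 0%MM; first by rewrite mulr1.
rewrite mulr0 => m0.
have [i mi] : exists i, m i != 0%N.
  apply: NNPP => h; case/eqP: m0; apply/mnmP => i; rewrite mnm0E.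
  by apply/eqP/negPn/negP => mi; apply: h; exists i.
(* The derivative has at [m - U_(i)] the coefficient of [p] at [m] times [m i], which is nonzero in
   characteristic zero. *)
have := congr1 (fun q => q@_(m - U_(i))) (hp i) => /=.
rewrite mcoeff_deriv mcoeff0 addmC addmBA ?[(U_(i) + m)%MM]addmC ?addmK; last first.
  by apply/mnm_lepP => j; rewrite mnm1E; case: eqP => // <-; rewrite lt0n.
move/eqP; rewrite -mulr_natr mulf_eq0 => /orP [/eqP //|].
by rewrite (proj1 (pcharf0P K) char0).
Qed.

Lemma msize_mderiv (p : {mpoly K[n]}) N i :
  (msize p <= N.+1)%N -> (msize (mderiv i p) <= N)%N.
Proof.
move=> pN; rewrite msizeE; apply/bigmax_leqP_seq => m; rewrite mcoeff_msupp mcoeff_deriv.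
move=> h _; have: (m + U_(i))%MM \in msupp p.
  by rewrite mcoeff_msupp; apply: contra h => /eqP ->; rewrite mul0rn.
by move=> /msize_mdeg_lt; rewrite mdegD mdeg1 addn1 => /leq_trans /(_ pN).
Qed.

(** Differentiating the relation along the [X i] and applying [nakayama] puts the partial
    derivatives of [p] in the kernel. They are 0 by induction on the size, so [p] is constant. *)
Lemma coord_map_inj0 p : coord_map p = 0 -> p = 0.
Proof.
move: {2}(msize p) (leqnn (msize p)) => N; elim: N p => [|N IH] p pN p0.
  by apply/eqP; rewrite -msize_poly_eq0 -leqn0.
have d0 i : mderiv i p = 0.
  apply: IH; first exact: msize_mderiv.
  apply: (nakayama (b := fun j => coord_map (mderiv j p))) => k.
  by rewrite -coord_map_chain p0 (lin0 (proj1 (Xder k))).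
move: p0; rewrite (mderiv_eq0_const d0) /coord_map mmapC /= => /eqP.
by rewrite scaler_eq0 oner_eq0 orbF => /eqP ->; rewrite mpolyC0.
Qed.

Lemma coord_map_surj a : exists p, coord_map p = a.
Proof.
elim/cotangent_generate: a => [|k|c u v [p <-] [q <-]|u v [p <-] [q <-]].
- by exists 1; apply: coord_map1.
- by exists 'X_k; apply: coord_mapX.
- by exists (c *: p + q); apply: lin_coord_map.
- by exists (p * q); apply: coord_mapM.
Qed.

Lemma polynomial_algebra : exists phi psi, @poly_alg_iso K n A phi psi.
Proof.
pose psi a := sval (constructive_indefinite_description _ (coord_map_surj a)).
have psiK a : coord_map (psi a) = a.
  by rewrite /psi; case: constructive_indefinite_description.
exists coord_map, psi; split=> //.
- exact: lin_coord_map.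
- exact: coord_map1.
- exact: coord_mapM.
move=> p; apply/eqP; rewrite -subr_eq0; apply/eqP; apply: coord_map_inj0.
by rewrite (linB _ _ lin_coord_map) psiK subrr.
Qed.

End Coordinates.

(** * Commutation of left and right translations *)

Section Commuting.
Variables (K : fieldType) (A : comAlgType K) (br : A -> A -> A).
Variables (dl : A -> seq (A * A)) (eps S : A -> A).
Hypothesis H : sweedler br dl eps S.

(** By coassociativity both sides are the convolution of [zeta'], [id] and [zeta]. *)
Lemma conv_scalar_comm (zeta zeta' : A -> A) a :
  lin zeta -> lin zeta' -> scalar_valued zeta -> scalar_valued zeta' ->
  conv dl id zeta (conv dl zeta' id a) = conv dl zeta' id (conv dl id zeta a).
Proof.
move=> lz lz' [e eE] [e' eE'].
have lL : lin (conv dl id zeta) by apply: (sw_lin H).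
have lR : lin (conv dl zeta' id) by apply: (sw_lin H).
transitivity (conv dl zeta' (conv dl id zeta) a).
  rewrite {2}/conv (lin_sum _ _ _ lL); apply: eq_bigr => p _.
  by rewrite eE' !mulr_algl (linZ _ _ lL).
rewrite -(sw_assoc H) //.
have -> : conv dl id zeta a = \sum_(p <- dl a) p.1 * zeta p.2 by [].
by rewrite (lin_sum _ _ _ lR); apply: eq_bigr => p _; rewrite eE !mulr_algr (linZ _ _ lR).
Qed.

End Commuting.

(** * Polynomiality and unimodularity of the Poisson Hopf algebra *)

Section Main.
Variables (K : fieldType) (A : comAlgType K) (br : A -> A -> A).
Hypothesis char0 : [pchar K] =i pred0.
Hypothesis brP : poisson_bracket br.
Variables (dl : A -> seq (A * A)) (eps S : A -> A).
Hypothesis H : sweedler br dl eps S.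
Variables (G : nat -> A -> Prop) (d : nat).
Hypotheses (GP : connected_graded G) (brG : bracket_homogeneous G br d).
Hypothesis Afg : fin_gen_alg A.
Local Notation o := (origin GP).

Let oM := algmor_origin GP.
Let oK := origin_scalar GP.

Theorem hopf_polynomial : exists n phi psi, @poly_alg_iso K n A phi psi.
Proof.
have [n [x [e [xG xspan xfree]]]] := cotangent_basis GP Afg.
exists n; pose xi := cotangent_coord xspan.
have dxi k : deriv_along o (xi k) by apply: der_coord.
apply: (polynomial_algebra xG xspan char0 (X := fun i => invariant_field dl S o (xi i))).
  by move=> i; apply: (der_invariant_field H oM).
move=> i j; rewrite (invariant_field_at_o H oM oK) //; last exact: scalar_coord.
by rewrite /xi /cotangent_coord (coord_x xG _ xfree) eq_sym scaler_nat.
Qed.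

Variables (n : nat) (phi : {mpoly K[n]} -> A) (psi : A -> {mpoly K[n]}).
Hypothesis iso : poly_alg_iso phi psi.

Let lphi : lin phi. Proof. by case: iso. Qed.
Let phi1 : phi 1 = 1. Proof. by case: iso. Qed.
Let phiM p q : phi (p * q) = phi p * phi q. Proof. by case: iso. Qed.
Let phiK : cancel phi psi. Proof. by case: iso. Qed.
Let psiK : cancel psi phi. Proof. by case: iso. Qed.

Let lpsi : lin psi.
Proof. by move=> c a b; apply: (can_inj phiK); rewrite lphi !psiK. Qed.
Let psiM a b : psi (a * b) = psi a * psi b.
Proof. by apply: (can_inj phiK); rewrite phiM !psiK. Qed.

(** The isomorphism is arbitrary, so these coordinates need be neither homogeneous nor zero at
    [o]. *)
Let y k := phi 'X_k.
Let D k a := phi (mderiv k (psi a)).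

Let lD k : lin (D k).
Proof. by move=> c a b; rewrite /D lpsi mderivD mderivZ lphi. Qed.

Let Dder k : deriv_along id (D k).
Proof.
split=> // a b; rewrite /D psiM mderivM (linD _ _ lphi) !phiM !psiK; ring.
Qed.

Let Dy k j : D k (y j) = (k == j)%:R.
Proof.
rewrite /D /y phiK mderiv_var.
by case: eqP; rewrite ?phi1 // (lin0 lphi).
Qed.

Let der_basis chi Y : algmor chi -> deriv_along chi Y ->
  forall a, Y a = \sum_k chi (D k a) * Y (y k).
Proof.
move=> chiM dY a; rewrite -[in LHS](psiK a).
exact: (mpoly_chain lphi phi1 phiM chiM dY).
Qed.

Let unit_scalar (u v : A) : u * v = 1 -> exists c : K, u = c%:A.
Proof.
move=> uv; have vu : psi v * psi u = 1.
  by rewrite -psiM mulrC uv -phi1 phiK.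
have := mpoly_intro_unit vu; rewrite unfold_in /= => /andP [/eqP e _].
exists (psi u)@_0; rewrite -[LHS]psiK e mcoeffC eqxx mulr1.
by rewrite -[_%:MP]mulr1 mul_mpolyC (linZ _ _ lphi) phi1.
Qed.

Let xi k a := o (D k a).

Let xiM k : deriv_along o (xi k).
Proof.
have [lo _ om] := oM; have [lDk mD] := Dder k.
split; first exact: lin_comp.
by move=> a b; rewrite /xi mD (linD _ _ lo) !om.
Qed.

Let xiK k : scalar_valued (xi k).
Proof. by have [e eE] := oK; exists (fun a => e (D k a)) => a; apply: eE. Qed.

Let xi_basis Y : deriv_along o Y -> forall a, Y a = \sum_k xi k a * Y (y k).
Proof. by move=> dY a; apply: der_basis. Qed.

(* The trace of the linear part of [br a] at the origin may be computed in
   homogeneous coordinates, where it vanishes for degree reasons. *)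
Lemma origin_divergence a : o (divergence y D (br a)) = 0.
Proof.
have [n' [x [e [xG xspan xfree]]]] := cotangent_basis GP Afg.
have [[Br _] _ _ _] := brP; have [lo _ _] := oM.
rewrite (lin_sum _ _ _ lo) -[RHS](coord_bracket_trace xG xspan xfree a brP brG).
transitivity (\sum_j \sum_k cotangent_coord xspan k (br a (y j)) * xi j (x k)).
  by apply: eq_bigr => j _; exact: (cotangent_coord_basis xspan (xiM j) (br a (y j))).
rewrite exchange_big; apply: eq_bigr => k _ /=.
(* Because brackets vanish at [o], [Y] is a derivation along [o] and expands in the coordinates
   [y]. *)
pose Y z := cotangent_coord xspan k (br a z).
have [lc mc] := der_coord xspan xfree k.
have dY : deriv_along o Y.
  split; first by apply: (lin_comp lc); apply: Br.
  move=> b c; rewrite /Y bracket_leibniz_r // (linD _ _ lc) !mc.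
  by rewrite !(origin_bracket GP brP brG); ring.
rewrite -/(Y (x k)) (xi_basis dY); apply: eq_bigr => j _; exact: mulrC.
Qed.

Theorem hopf_unimodular f :
  modular_derivation (fun p q => psi (br (phi p) (phi q))) f = 0.
Proof.
have Hop := sweedler_op H.
have choose_f (F : 'I_n -> A -> A) : (forall i, exists g : 'I_n -> 'I_n -> K, forall a b,
    F i (br a b) = br (F i a) b + br a (F i b)
      + \sum_k \sum_l g k l *: (F k a * F l b)) ->
    exists g : 'I_n -> 'I_n -> 'I_n -> K, forall i a b,
      F i (br a b) = br (F i a) b + br a (F i b)
      + \sum_k \sum_l g i k l *: (F k a * F l b).
  move=> h; exists (fun i => sval (constructive_indefinite_description _ (h i))) => i.
  by case: constructive_indefinite_description.
have [fL L_br] := choose_f _ (invariant_field_bracket H brP oM oK xiM xiK xi_basis).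
have [fR R_br] := choose_f _ (invariant_field_bracket Hop brP oM oK xiM xiK xi_basis).
(* Under [phi] the modular derivation becomes the divergence of [br (phi f)]. *)
apply: (can_inj phiK); rewrite (lin0 lphi) (lin_sum _ _ _ lphi).
have two_neq0 : (2%:R : K) != 0 by rewrite (proj1 (pcharf0P K) char0).
(* These are the coefficients of [D j] supplied by [invariant_frame]; [dl] gives the frame [L] and
   [opdl dl] the frame [R]. *)
pose c dl' j i := conv dl' o (conv dl' S (D j)) (y i).
apply: (hamiltonian_divergence0 (cL := c dl) (cR := c (opdl dl)) brP Dy _ unit_scalar oM _ origin_divergence
  _ _ L_br R_br _ _ _ two_neq0).
- by move=> X dX a; apply: (der_basis (algmor_id A) dX).
- exact: (origin_bracket GP brP brG).
- by move=> j a; apply: (invariant_frame H oM xi_basis (Dder j)).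
- by move=> j a; apply: (invariant_frame Hop oM xi_basis (Dder j)).
- by move=> i a; rewrite (invariant_field_at_o H oM oK).
- by move=> i a; rewrite (invariant_field_at_o Hop oM oK).
(* Rewritten through [dl], the second field convolves from the left, so it commutes with the
   first. *)
move=> i j a; rewrite /invariant_field conv_opdl.
have [[l1 _] [l2 _]] := (der_tangent H oM (xiM i), der_tangent Hop oM (xiM j)).
by rewrite (conv_scalar_comm H) //; apply: scalar_tangent.
Qed.

End Main.

Theorem theorem0p1 :
  forall (K : closedFieldType), [pchar K] =i pred0 ->
  forall (A : comAlgType K) (br : A -> A -> A)
         (T : lmodType K) (t : A -> A -> T) (T3 : lmodType K) (t3 : T -> A -> T3)
         (Delta : A -> T) (eps : A -> K) (S : A -> A)
         (G : nat -> A -> Prop) (d : nat),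
    is_poisson_hopf br t t3 Delta eps S ->
    fin_gen_alg A ->
    connected_graded G ->
    bracket_homogeneous G br d ->
    (exists (n : nat) (phi : {mpoly K[n]} -> A) (psi : A -> {mpoly K[n]}),
        poly_alg_iso phi psi) /\
    (forall (n : nat) (phi : {mpoly K[n]} -> A) (psi : A -> {mpoly K[n]}),
        poly_alg_iso phi psi ->
        forall f : {mpoly K[n]},
          modular_derivation (fun p q => psi (br (phi p) (phi q))) f = 0).
Proof.
move=> K char0 A br T t T3 t3 Delta eps S G d H Afg GP brG.
have brP : poisson_bracket br by case: H.
have Hs := sweedler_of_hopf H.
split; first exact: (hopf_polynomial char0 Hs GP Afg).
by move=> n phi psi iso f; apply: (hopf_unimodular char0 brP Hs GP brG Afg iso).
Qed.
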